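(* Suppose that the networks $\mathcal{N}$, $\mathcal{N}^{0}$, $\mathcal{N}^{+}$ and $\mathcal{N}^{\prime}$ (defined in the context) are all initially empty at time $0$ and are coupled as described in the context. Then the following holds. (i) For any $t>0$, $$\sum_{i=1}^{d}Y_{i}(t)\leq\sum_{i=1}^{d}Y_{i}^{0}(t)\leq\sum_{i=1}^{d}Y_{i}^{+}(t).$$ (ii) For any $t>0$ and any $i$, when $Y_{i}^{\prime}(t)=y_{i}$, the service station $i$ in system $\mathcal{N}^{+}$ must satisfy $Y_{i}^{+}(t)\leq y_{i}+1$ and $S_{i}^{+}(t)\in\{0,1\}$. (iii) The network $\mathcal{N}^{+}$, driven by the vacation equations (V) of the context, is monotone in the initial condition. In other words, let $y_{i}\in\{0,1,\dots\}$ for $i=1,\dots,d$, and let $(\widehat{Y}^{++},\widehat{S}^{++},Y^{++})$, $(\widehat{Y}^{+},\widehat{S}^{+},Y^{+})$, $(\widehat{Y}^{+-},\widehat{S}^{+-},Y^{+-})$ be three solutions of the equations (V), driven by the same processes $N_i$, $D_i$, $D_{j,i}$, with initial conditions, for every $i$: $\widehat{Y}_{i}^{++}(0)=y_{i}+1$, $\widehat{S}_{i}^{++}(0)=1$; $\widehat{Y}_{i}^{+}(0)\leq y_{i}$, $\widehat{S}_{i}^{+}(0)\in\{0,1\}$; and $\widehat{Y}_{i}^{+-}(0)=0=\widehat{S}_{i}^{+-}(0)$. Then $Y_{i}^{++}(t)\geq Y_{i}^{+}(t)\geq Y_{i}^{+-}(t)$ for all $t\geq0$ and all $i$.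
   Context: **The network $\mathcal{N}$ (generalized Jackson network).** There are $d$ single-server stations with infinite waiting rooms, each operating first-in-first-out. Station $i$ receives external arrivals at the times $A_i(1)<A_i(2)<\cdots$ of a renewal process: with $A_i(0)=0$, the interarrival times $U_i(n)=A_i(n)-A_i(n-1)$ are i.i.d. with $E[U_i(n)]=1/\lambda_i\in(0,\infty]$; if $\lambda_i=0$ then $A_i(n)=\infty$ (no external arrivals), and by convention $\lambda_iU_i(1)=0$. At least one $\lambda_i>0$. The $k$-th customer served at station $i$ has service time $\sigma_i(k)$, i.i.d. in $k$ with $E[\sigma_i(k)]=1/\mu_i\in(0,\infty)$, and upon completion receives a routing indicator $r_i(k)\in\{0,1,\dots,d\}$, i.i.d. in $k$ with $P(r_i(k)=j)=Q_{i,j}$: it leaves the network if $r_i(k)=0$ and otherwise joins the queue of station $r_i(k)$. All interarrival, service and routing sequences are mutually independent, across stations too. $Q=(Q_{i,j})_{1\le i,j\le d}$ is substochastic, $Q_{i,0}=1-\sum_{j=1}^dQ_{i,j}$, $Q_{i,i}=0$, and $Q^n\to0$. The network is stable: $\phi=(I-Q^T)^{-1}\lambda<\mu$ componentwise. $Y_i(t)$ is the number of customers at station $i$ at time $t$ (in queue plus in service). **Standing assumptions.** (1) If $\lambda_i>0$ then $P(U_i(1)>m)>0$ for all $m\in(0,\infty)$. (2) There is $\delta>0$ such that for all $i$, $\sup_{t\ge0}E[\exp(\delta\lambda_i(U_i(1)-t))\mid U_i(1)>t]<\infty$ and $\sup_{t\ge0}E[\exp(\delta(\sigma_i(1)-t))\mid\sigma_i(1)>t]<\infty$.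 (3) Interarrival and service times, and the exponential tiltings of their distributions, can be simulated exactly. (4) Interarrival times and service times have continuous distributions. **The network $\mathcal{N}^0$.** Fix constants $a_i\ge1$ such that, with $\mu_i^0=\mu_i/a_i$, $\lambda<(I-Q^T)\mu^0$ componentwise. $\mathcal{N}^0$ evolves by the same rules as $\mathcal{N}$, with the same arrivals $A_i(n)$ and routing indicators $r_i(k)$, but with service times $\sigma_i^0(k)=a_i\sigma_i(k)$ (again assigned to the $k$-th customer served at station $i$). $Y_i^0(t)$ is its number of customers at station $i$ (queue plus service). **The vacation network $\mathcal{N}^+$.** It evolves as $\mathcal{N}^0$, with the same $A_i(n)$ and $(r_i(k),\sigma_i^0(k))$, except that whenever server $i$ completes an activity (a service or a vacation) and finds no customer waiting in its queue, it starts a vacation. The $k$-th vacation of server $i$ has length $v_i^0(k)$; the sequence $(v_i^0(k))_k$ is an i.i.d. copy of $(\sigma_i^0(k))_k$, and the vacation periods are independent of each other and of everything else. Vacations are not interrupted by arrivals; at the end of an activity, if some customer is waiting, the server serves the first one waiting. When initially empty, every server starts a vacation at time $0$. $\widehat{Y}_i^+(t)$ is the number of customers waiting in queue at station $i$, $S_i^+(t)=\widehat{S}_i^+(t)\in\{0,1\}$ the number in service, and $Y_i^+(t)=\widehat{Y}_i^+(t)+S_i^+(t)$. **The autonomous network $\mathcal{N}'$.** Let $N_i(t)=\max\{n\ge0:A_i(n)\le t\}$. Let $(V_i^0(k))_{k\ge1}$ be i.i.d. with the law of $\sigma_i^0(1)$, $B_i(0)=0$, $B_i(n)=V_i^0(1)+\cdots+V_i^0(n)$,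 $D_i(t)=\max\{n\ge0:B_i(n)\le t\}$; let $(r_i'(k))_{k\ge1}$ be i.i.d. with $P(r_i'(k)=j)=Q_{i,j}$, $j\in\{0,\dots,d\}$, and $D_{i,j}(t)=\sum_{k=1}^{D_i(t)}I(r_i'(k)=j)$. All $V_i^0(k)$, $r_i'(k)$ are mutually independent and independent of the $A_i(k)$. The number of customers $Y_i'(t)$ in the queue at station $i$ of $\mathcal{N}'$ solves $$dY_i'(t)=dN_i(t)+\sum_{j\ne i,\,1\le j\le d}dD_{j,i}(t)-I(Y_i'(t_-)>0)\,dD_i(t),$$ with $Y_i'(0)=0$ when initially empty. **Coupling of $\mathcal{N}^+$ and $\mathcal{N}'$.** Both share the external arrivals, and each interval between jumps of $D_i$ is an activity period of server $i$ in $\mathcal{N}^+$. Thus $\mathcal{N}^+$ evolves according to the vacation equations $$\text{(V)}\quad\begin{aligned}d\widehat{Y}_i^+(t)&=dN_i(t)+\sum_{j\ne i,\,1\le j\le d}I(\widehat{S}_j^+(t_-)>0)\,dD_{j,i}(t)-I(\widehat{Y}_i^+(t_-)>0)\,dD_i(t),\\ d\widehat{S}_i^+(t)&=\big(I(\widehat{Y}_i^+(t_-)>0)-I(\widehat{S}_i^+(t_-)>0)\big)\,dD_i(t),\\ Y_i^+(t)&=\widehat{Y}_i^+(t)+\widehat{S}_i^+(t).\end{aligned}$$ The sequences $(\sigma_i^0(k),r_i(k))_k$ and $(v_i^0(k))_k$ are extracted as follows: for $n=1,2,\dots$, if server $i$ is in service just before time $B_i(n)$ (i.e. $S_i^+(B_i(n)-)=1$),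 then $V_i^0(n)$ and $r_i'(n)$ become the next terms of $(\sigma_i^0(k))$ and $(r_i(k))$; otherwise $V_i^0(n)$ becomes the next term of $(v_i^0(k))$. The extracted $(\sigma_i^0(k),r_i(k))$ drive $\mathcal{N}^0$, and $\mathcal{N}$ is driven by $\sigma_i(k)=\sigma_i^0(k)/a_i$ and the same $r_i(k)$, with the same external arrivals. *)

(* Defs.v *)
From HB Require Import structures.
From mathcomp Require Import all_boot all_order all_algebra.
From mathcomp Require Import all_classical all_reals all_analysis.
From mathcomp Require Import measurable_realfun.

Set Implicit Arguments.
Unset Strict Implicit.
Unset Printing Implicit Defensive.

Import Order.TTheory GRing.Theory Num.Theory.
Import numFieldNormedType.Exports.

Local Open Scope classical_set_scope.
Local Open Scope ring_scope.

(* Conventions.  Stations are the elements of 'I_d.  Sequences of interarrival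
   times, service times, vacations, activity lengths and routing indicators,
   indexed by n >= 1 on paper, are indexed from 0: term n is the (n+1)-st one.
   Sequences of epochs (arrivals, completions, ends of activities) keep their
   conventional value 0 at index 0, so that term n is the n-th epoch.
   A routing indicator is an [option 'I_d]: [None] (0 on paper) means that the
   customer leaves the network, [Some j] that it joins station j. *)

HB.instance Definition _ (d : nat) :=
  @isMeasurable.Build default_measure_display (option 'I_d)
    discrete_measurable discrete_measurable0
    discrete_measurableC discrete_measurableU.

Definition same_law {d d'} {T : measurableType d} {T' : measurableType d'}
    {R : realType} (P : probability T R) (X Y : T -> T') : Prop :=
  forall B : set T', measurable B -> P (X @^-1` B) = P (Y @^-1` B).

Definition events {d d'} {T : measurableType d} {T' : measurableType d'}
    (X : T -> T') : set (set T) :=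
  preimage_set_system [set: T] X measurable.

Definition mutually_independent {d} {T : measurableType d} {R : realType}
    (P : probability T R) (I : eqType) (F : I -> set (set T)) : Prop :=
  forall (s : seq I) (E : I -> set T), uniq s ->
    (forall i, i \in s -> F i (E i)) ->
    P (\big[setI/[set: T]]_(i <- s) E i) = (\prod_(i <- s) P (E i))%E.

(* Continuity of the distribution function; [X] may be extended real-valued. *)
Definition continuous_law {d} {T : measurableType d} {R : realType}
    (P : probability T R) (X : T -> \bar R) : Prop :=
  continuous (fun x : R => P [set w | (X w <= x%:E)%E]).

(* E[X | E]; it is 0 when P E = 0, which does not affect the suprema of
   nonnegative quantities below. *)
Definition cond_expectation {d} {T : measurableType d} {R : realType}
    (P : probability T R) (X : T -> \bar R) (E : set T) : \bar R :=
  ((fine (P E))^-1%:E * \int[P]_(w in E) X w)%E.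

(* max{n >= 0 : e n <= t}, with the junk value 0 if there is no maximum. *)
Definition count_upto {R : realType} (e : nat -> \bar R) (t : R) : nat :=
  xget 0%N [set n | (e n <= t%:E)%E /\
                    forall m, (e m <= t%:E)%E -> (m <= n)%N].

(* f(t-), for the discrete topology of nat. *)
Definition left_lim {R : realType} (f : R -> nat) (t : R) : nat :=
  lim (f s @[s --> t^'-]).

(* The integral of f over (0, t] against dD, D being a counting process: the
   sum over the jump times s of D of f(s) times the jump of D at s. *)
Definition jump_integral {R : realType} (f : R -> int) (D : R -> nat) (t : R)
    : int :=
  \sum_(s \in `]0, t]%classic) f s * ((D s)%:Z - (left_lim D s)%:Z).

Record network_parameters (R : realType) (d : nat) (lam mu : 'I_d -> R)
    (Q : 'M[R]_d) : Prop := {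
  lam_ge0 : forall i, 0 <= lam i ;
  lam_pos : exists i, 0 < lam i ;
  mu_gt0 : forall i, 0 < mu i ;
  Q_ge0 : forall i j, 0 <= Q i j ;
  Q_substochastic : forall i, \sum_j Q i j <= 1 ;
  Q_diag : forall i, Q i i = 0 ;
  Q_transient : (fun n => Q ^+ n) @ \oo --> (0 : 'M[R]_d) ;
  stability : forall i,
    (invmx (1%:M - Q^T) *m (\col_j lam j)) i ord0 < mu i
}.

Record slowdown_parameters (R : realType) (d : nat) (lam mu : 'I_d -> R)
    (Q : 'M[R]_d) (a : 'I_d -> R) : Prop := {
  a_ge1 : forall i, 1 <= a i ;
  slow_stability : forall i,
    lam i < ((1%:M - Q^T) *m (\col_j (mu j / a j))) i ord0
}.

(* A_i(n), from the interarrival times U *)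
Definition arrival_epoch {R : realType} {d : nat} (U : 'I_d -> nat -> \bar R)
    (i : 'I_d) (n : nat) : \bar R :=
  (\sum_(k < n) U i k)%E.

(* B_i(n), from the activity lengths V *)
Definition activity_epoch {R : realType} {d : nat} (V : 'I_d -> nat -> R)
    (i : 'I_d) (n : nat) : R :=
  \sum_(k < n) V i k.

(* N_i(t) *)
Definition external_count {R : realType} {d : nat} (U : 'I_d -> nat -> \bar R)
    (i : 'I_d) (t : R) : nat :=
  count_upto (arrival_epoch U i) t.

(* D_i(t) *)
Definition activity_count {R : realType} {d : nat} (V : 'I_d -> nat -> R)
    (i : 'I_d) (t : R) : nat :=
  count_upto (fun n => (activity_epoch V i n)%:E) t.

(* D_{i,j}(t) *)
Definition routed_count {R : realType} {d : nat} (V : 'I_d -> nat -> R)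
    (r' : 'I_d -> nat -> option 'I_d) (i j : 'I_d) (t : R) : nat :=
  (\sum_(k < activity_count V i t) (r' i k == Some j))%N.

Definition routing_law {disp} {Omega : measurableType disp} {R : realType}
    (P : probability Omega R) (d : nat) (Q : 'M[R]_d)
    (r : 'I_d -> nat -> Omega -> option 'I_d) : Prop :=
  forall i k,
    (forall j, P (r i k @^-1` [set Some j]) = (Q i j)%:E) /\
    P (r i k @^-1` [set None]) = (1 - \sum_j Q i j)%:E.

(* When lam i = 0 there are no external arrivals at i: U i n = +oo, and the
   mean is 0^-1 = +oo. *)
Record network_primitives {disp} {Omega : measurableType disp} {R : realType}
    (P : probability Omega R) (d : nat) (lam mu : 'I_d -> R) (Q : 'M[R]_d)
    (U : 'I_d -> nat -> {RV P >-> \bar R}) (sg : 'I_d -> nat -> {RV P >-> R})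
    (r : 'I_d -> nat -> {RV P >-> option 'I_d}) : Prop := {
  U_ge0 : forall i n w, (0 <= U i n w)%E ;
  U_none : forall i, lam i = 0 -> forall n w, U i n w = +oo%E ;
  A_increasing : forall i, 0 < lam i -> forall n w,
    (arrival_epoch (fun i n => U i n w) i n.+1 <
     arrival_epoch (fun i n => U i n w) i n.+2)%E ;
  U_same_law : forall i n, same_law P (U i n) (U i 0%N) ;
  U_mean : forall i, (\int[P]_w U i 0%N w = (lam i)%:E^-1)%E ;
  sg_ge0 : forall i k w, 0 <= sg i k w ;
  sg_same_law : forall i k, same_law P (sg i k) (sg i 0%N) ;
  sg_mean : forall i, ('E_P[sg i 0%N] = (mu i)^-1%:E)%E ;
  r_law : routing_law P Q (fun i k => r i k) ;
  primitives_independent : mutually_independent P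
    (fun x : 'I_d * nat + 'I_d * nat + 'I_d * nat =>
       match x with
       | inl (inl (i, n)) => events (U i n)
       | inl (inr (i, k)) => events (sg i k)
       | inr (i, k) => events (r i k)
       end)
}.

(* With lam i = 0 and U i 0 = +oo the product lam i * U i 0 is 0 in \bar R,
   which is the convention wanted in [U_exp_tail]. *)
Record standing_assumptions {disp} {Omega : measurableType disp}
    {R : realType} (P : probability Omega R) (d : nat) (lam : 'I_d -> R)
    (U : 'I_d -> nat -> {RV P >-> \bar R}) (sg : 'I_d -> nat -> {RV P >-> R})
    : Prop := {
  U_unbounded : forall i, 0 < lam i -> forall m : R, 0 < m ->
    (0 < P [set w | m%:E < U i 0%N w])%E ;
  exp_tails : exists delta : R, 0 < delta /\ forall i,
    (ereal_sup [set cond_expectation P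
        (fun w => expeR (delta%:E * ((lam i)%:E * (U i 0%N w - t%:E))))
        [set w | t%:E < U i 0%N w] | t in [set t : R | (0 <= t)%R]]
     < +oo)%E /\
    (ereal_sup [set cond_expectation P
        (fun w => (expR (delta * (sg i 0%N w - t))%R)%:E)
        [set w | (t < sg i 0%N w)%R] | t in [set t : R | (0 <= t)%R]]
     < +oo)%E ;
  U_continuous : forall i, 0 < lam i -> continuous_law P (U i 0%N) ;
  sg_continuous : forall i, continuous_law P (fun w => (sg i 0%N w)%:E)
}.

(* The vacations: an i.i.d. copy of the service times a_i sg_i(k), independent
   of everything driving the other networks. *)
Record vacation_primitives {disp} {Omega : measurableType disp}
    {R : realType} (P : probability Omega R) (d : nat) (a : 'I_d -> R)
    (U : 'I_d -> nat -> {RV P >-> \bar R}) (sg : 'I_d -> nat -> {RV P >-> R})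
    (r : 'I_d -> nat -> {RV P >-> option 'I_d})
    (v : 'I_d -> nat -> {RV P >-> R}) : Prop := {
  v_law : forall i k, same_law P (v i k) (fun w => a i * sg i 0%N w) ;
  v_independent : mutually_independent P
    (fun x : 'I_d * nat + 'I_d * nat + 'I_d * nat + 'I_d * nat =>
       match x with
       | inl (inl (inl (i, n))) => events (U i n)
       | inl (inl (inr (i, k))) => events (sg i k)
       | inl (inr (i, k)) => events (r i k)
       | inr (i, k) => events (v i k)
       end)
}.

Record autonomous_primitives {disp} {Omega : measurableType disp}
    {R : realType} (P : probability Omega R) (d : nat) (Q : 'M[R]_d)
    (a : 'I_d -> R) (U : 'I_d -> nat -> {RV P >-> \bar R})
    (sg : 'I_d -> nat -> {RV P >-> R}) (V : 'I_d -> nat -> {RV P >-> R})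
    (r' : 'I_d -> nat -> {RV P >-> option 'I_d}) : Prop := {
  V_law : forall i k, same_law P (V i k) (fun w => a i * sg i 0%N w) ;
  r'_law : routing_law P Q (fun i k => r' i k) ;
  autonomous_independent : mutually_independent P
    (fun x : 'I_d * nat + 'I_d * nat + 'I_d * nat =>
       match x with
       | inl (inl (i, n)) => events (U i n)
       | inl (inr (i, k)) => events (V i k)
       | inr (i, k) => events (r' i k)
       end)
}.

(* Number of arrivals, external and internal, at station i up to time t, when
   C j n is the epoch of the n-th service completion at station j. *)
Definition total_arrivals {R : realType} {d : nat} (U : 'I_d -> nat -> \bar R)
    (r : 'I_d -> nat -> option 'I_d) (C : 'I_d -> nat -> \bar R)
    (i : 'I_d) (t : R) : nat :=
  (external_count U i t +
   \sum_(j < d) \sum_(k < count_upto (C j) t) (r j k == Some i))%N.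

(* Epoch of the n-th arrival at station i (+oo if there is none). *)
Definition total_arrival_epoch {R : realType} {d : nat}
    (U : 'I_d -> nat -> \bar R) (r : 'I_d -> nat -> option 'I_d)
    (C : 'I_d -> nat -> \bar R) (i : 'I_d) (n : nat) : \bar R :=
  ereal_inf [set t%:E | t in [set t : R | (n <= total_arrivals U r C i t)%N]].

(* Initially empty network of single-server FIFO stations with interarrival
   times U, service times sg and routing indicators r.  By the FIFO discipline
   the k-th customer served at i is the k-th one to arrive there; its service
   starts as soon as it has arrived and the (k-1)-st service is completed.
   Y i t is the number of customers at i (in queue and in service). *)
Record jackson_network (R : realType) (d : nat) (U : 'I_d -> nat -> \bar R)
    (sg : 'I_d -> nat -> R) (r : 'I_d -> nat -> option 'I_d)
    (C : 'I_d -> nat -> \bar R) (Y : 'I_d -> R -> nat) : Prop := {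
  completion0 : forall i, C i 0%N = 0%E ;
  completionS : forall i k,
    C i k.+1 = (maxe (C i k) (total_arrival_epoch U r C i k.+1)
                + (sg i k)%:E)%E ;
  population : forall i t, 0 <= t ->
    (Y i t)%:Z = (total_arrivals U r C i t)%:Z - (count_upto (C i) t)%:Z
}.

(* The vacation equations (V), integrated over (0, t], for given driving
   processes N_i, D_i, D_{j,i}. *)
Record vacation_solution (R : realType) (d : nat) (N D : 'I_d -> R -> nat)
    (DD : 'I_d -> 'I_d -> R -> nat) (Yh S Y : 'I_d -> R -> nat) : Prop := {
  waiting_eq : forall i t, 0 <= t ->
    (Yh i t)%:Z - (Yh i 0)%:Z =
      ((N i t)%:Z - (N i 0)%:Z)
      + \sum_(j < d | j != i)
          jump_integral (fun s => (0 < left_lim (S j) s)%N%:Z) (DD j i) t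
      - jump_integral (fun s => (0 < left_lim (Yh i) s)%N%:Z) (D i) t ;
  in_service_eq : forall i t, 0 <= t ->
    (S i t)%:Z - (S i 0)%:Z =
      jump_integral (fun s => (0 < left_lim (Yh i) s)%N%:Z
                              - (0 < left_lim (S i) s)%N%:Z) (D i) t ;
  present_eq : forall i t, 0 <= t -> Y i t = (Yh i t + S i t)%N
}.

Record autonomous_solution (R : realType) (d : nat) (N D : 'I_d -> R -> nat)
    (DD : 'I_d -> 'I_d -> R -> nat) (Y : 'I_d -> R -> nat) : Prop := {
  autonomous_eq : forall i t, 0 <= t ->
    (Y i t)%:Z - (Y i 0)%:Z =
      ((N i t)%:Z - (N i 0)%:Z)
      + \sum_(j < d | j != i) ((DD j i t)%:Z - (DD j i 0)%:Z)
      - jump_integral (fun s => (0 < left_lim (Y i) s)%N%:Z) (D i) t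
}.

(* Server i is in service just before the end of its activity number n. *)
Definition serving {R : realType} {d : nat} (V : 'I_d -> nat -> R)
    (S : 'I_d -> R -> nat) (i : 'I_d) (n : nat) : bool :=
  left_lim (S i) (activity_epoch V i n.+1) == 1%N.

(* Extraction of the service times sg0, routing indicators r and vacations v
   from the activity lengths V and the indicators r'.  Terms that are never
   extracted are left free. *)
Definition extraction {R : realType} {d : nat} (V : 'I_d -> nat -> R)
    (r' : 'I_d -> nat -> option 'I_d) (S : 'I_d -> R -> nat)
    (sg0 : 'I_d -> nat -> R) (r : 'I_d -> nat -> option 'I_d)
    (v : 'I_d -> nat -> R) : Prop :=
  forall i n,
    if serving V S i n then
      let k := (\sum_(m < n) serving V S i m)%N in
      sg0 i k = V i n /\ r i k = r' i n
    else v i (\sum_(m < n) ~~ serving V S i m)%N = V i n.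

(* Main.v *)
Require Import Defs.
From HB Require Import structures.
From mathcomp Require Import all_boot all_order all_algebra.
From mathcomp Require Import all_classical all_reals all_analysis.
From mathcomp Require Import measurable_realfun.
From mathcomp Require Import zify ring.

Set Implicit Arguments.
Unset Strict Implicit.
Unset Printing Implicit Defensive.

Import Order.TTheory GRing.Theory Num.Theory.
Import numFieldNormedType.Exports.

Local Open Scope classical_set_scope.
Local Open Scope ring_scope.

(** All three claims hold path by path, outside a null set on which some
    service, activity or first interarrival time vanishes, some renewal
    sequence stays bounded, or a routing indicator sends a customer back to the
    station it leaves.  Off this null set the driving processes are step
    functions with finitely many jumps in bounded time, and the D_i have unit
    jumps.  Simultaneous jumps of different processes are harmless, because the
    effect of a jump depends on left limits only.

    Between jumps nothing changes, and at a jump the new state is a function of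
    the left limits ([waiting_jump], [server_jump]).  An inequality between two
    solutions is therefore proved by induction along the time axis
    ([real_induction]): it passes to left limits, survives the jump, and then
    persists for a while to the right.

    (iii) At the end of an activity the queue x becomes max(x - 1, 0) and the
    server becomes busy exactly when x > 0; a busy server forwards a customer.
    All of this is nondecreasing in the waiting and in-service numbers, so the
    componentwise order of the states is preserved ([vacation_monotone]).

    (ii) The autonomous queue obeys the same recursion, but every activity of
    another station feeds it whether or not that station was serving.  Hence it
    dominates the waiting line of the vacation network
    ([waiting_le_autonomous]); the customer in service accounts for the + 1.

    (i) The total population is the number of external arrivals minus the
    number of exits, so it suffices to compare service completions
    ([population_le]).  A work-conserving FIFO network completes services as
    early as possible: if in some other system each service takes at least as
    long and starts after the previous services of that station and after
    enough arrivals, then by induction on time that system is always behind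
    ([network_is_fastest]).  This applies to the network with longer service
    times ([slower_service_population]), and to the vacation network, whose
    servers start a service only at the end of an activity
    ([vacation_population_ge]). *)

(** * Step functions of time *)

(** The infimum of the times where [P] fails can neither satisfy [P], by the
    right-hand step, nor violate it, by the left-hand one or, at 0, by the
    base case. *)
Lemma real_induction (R : realType) (P : R -> Prop) :
  P 0 ->
  (forall t : R, 0 <= t -> P t -> \forall s \near t^'+, P s) ->
  (forall t : R, 0 < t -> (forall s : R, 0 <= s -> s < t -> P s) -> P t) ->
  forall t : R, 0 <= t -> P t.
Proof.
move=> P0 Pright Pleft t t0; apply: contrapT => NPt.
pose E := [set s : R | 0 <= s /\ ~ P s].
have E0 : E !=set0 by exists t.
have Elb : has_lbound E by exists 0 => s [].
have Pbelow (s : R) : 0 <= s -> s < inf E -> P s.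
  move=> s0 sE; apply: contrapT => NPs; move: sE; rewrite ltNge => /negP; apply.
  exact: ge_inf.
have infE0 : 0 <= inf E by apply: lb_le_inf => // s [].
have PE : P (inf E).
  case: (ltgtP 0 (inf E)) => [E_gt0||<-//]; last by rewrite ltNge infE0.
  exact: Pleft.
have [e /= e0 Pe] := Pright _ infE0 PE.
have [s [s0 NPs] sE] := inf_adherent e0 (conj E0 Elb).
have Es : inf E <= s by exact: ge_inf.
case: (ltgtP (inf E) s) Es => // [Es _|Es _]; last by apply: NPs; rewrite -Es.
apply/NPs/Pe => //=.
by rewrite distrC gtr0_norm ?subr_gt0// ltrBlDl.
Qed.

(** A right-continuous step function is described by its jumps: just after [t]
    it keeps its value, and just before [t] its value was smaller by
    [delta t].  Unlike a statement about left limits, this is closed under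
    sums and makes sense before left limits are known to exist. *)
Definition jumps_by (R : realType) (F delta : R -> int) : Prop :=
  (forall t : R, 0 <= t -> \forall s \near t^'+, F s = F t) /\
  (forall t : R, 0 < t -> \forall s \near t^'-, F s = F t - delta t).

Definition step_path (R : realType) (f : R -> nat) : Prop :=
  (forall t : R, 0 <= t -> \forall s \near t^'+, f s = f t) /\
  (forall t : R, 0 < t -> \forall s \near t^'-, f s = left_lim f t).

Lemma left_limE (R : realType) (f : R -> nat) (t : R) (n : nat) :
  (\forall s \near t^'-, f s = n) -> left_lim f t = n.
Proof. by apply: lim_near_cst => //; exact: discrete_hausdorff. Qed.

Section JumpsBy.
Variable R : realType.
Implicit Types (F G delta eps : R -> int) (f h : R -> nat).

Lemma jumps_by_cst (c : int) : jumps_by (cst c : R -> int) (cst 0).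
Proof.
by split=> t _; near=> s => //=; rewrite subr0.
Unshelve. all: by end_near. Qed.

Lemma jumps_byD F G delta eps : jumps_by F delta -> jumps_by G eps ->
  jumps_by (F \+ G) (delta \+ eps).
Proof.
move=> [Fr Fl] [Gr Gl]; split=> t t0.
  by apply: filterS2 (Fr t t0) (Gr t t0) => s /= -> ->.
by apply: filterS2 (Fl t t0) (Gl t t0) => s /= -> ->; rewrite opprD addrACA.
Qed.

Lemma jumps_byN F delta : jumps_by F delta -> jumps_by (\- F) (\- delta).
Proof.
move=> [Fr Fl]; split=> t t0.
  by apply: filterS (Fr t t0) => s /= ->.
by apply: filterS (Fl t t0) => s /= ->; rewrite opprB addrC opprK.
Qed.

Lemma jumps_by_sum (I : finType) (A : pred I) (F delta : I -> R -> int) :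
  (forall i, A i -> jumps_by (F i) (delta i)) ->
  jumps_by (fun t => \sum_(i | A i) F i t) (fun t => \sum_(i | A i) delta i t).
Proof.
move=> FA; split=> t t0.
  have : \forall s \near t^'+, forall i, A i -> F i s = F i t.
    apply: filter_forall => i; case: (boolP (A i)) => Ai; last exact: nearW.
    by apply: filterS ((FA i Ai).1 t t0) => s ->.
  by apply: filterS => s Fs; apply: eq_bigr.
have : \forall s \near t^'-, forall i, A i -> F i s = F i t - delta i t.
  apply: filter_forall => i; case: (boolP (A i)) => Ai; last exact: nearW.
  by apply: filterS ((FA i Ai).2 t t0) => s ->.
by apply: filterS => s Fs; rewrite -sumrB; apply: eq_bigr.
Qed.

Lemma eq_jumps_by F G delta eps :
  (forall t, 0 <= t -> F t = G t) -> (forall t, 0 < t -> delta t = eps t) ->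
  jumps_by F delta -> jumps_by G eps.
Proof.
move=> FG de [Fr Fl]; split=> t t0.
  near=> s; rewrite -FG ?(near (Fr t t0) s)// ?FG//.
  by apply: (le_trans t0); near: s; exact: nbhs_right_ge.
near=> s; rewrite -!FG ?(ltW t0) -?de ?(near (Fl t t0) s)//.
by near: s; exact: nbhs_left_ge.
Unshelve. all: by end_near. Qed.

Lemma jumps_by_comp f (G : nat -> int) : step_path f ->
  jumps_by (G \o f) (fun t => G (f t) - G (left_lim f t)).
Proof.
move=> [fr fl]; split=> t t0.
  by apply: filterS (fr t t0) => s /= ->.
by apply: filterS (fl t t0) => s /= ->; rewrite subKr.
Qed.

(** Reads off left limits: this turns an integrated equation for a population
    into a recursion over its jumps. *)
Lemma jumps_by_nat f delta : jumps_by (fun t => (f t)%:Z) delta ->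
  step_path f /\ forall t, 0 < t -> (f t)%:Z = (left_lim f t)%:Z + delta t.
Proof.
move=> [fr fl].
have fl' t : 0 < t -> (f t)%:Z = (left_lim f t)%:Z + delta t /\
    \forall s \near t^'-, f s = left_lim f t.
  move=> t0.
  have [s0 fs0] := @filter_ex _ _ (at_left_proper_filter t) _ (fl t t0).
  have fle : \forall s \near t^'-, f s = f s0.
    by apply: filterS (fl t t0) => s; rewrite -fs0 => -[].
  by rewrite (left_limE fle) fs0 subrK.
split; last by move=> t /fl'[].
split=> t t0; last by case: (fl' t t0).
by apply: filterS (fr t t0) => s [].
Qed.

Lemma jumps_by_step_path f : step_path f ->
  jumps_by (fun t => (f t)%:Z) (fun t => (f t)%:Z - (left_lim f t)%:Z).
Proof. exact: jumps_by_comp. Qed.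

End JumpsBy.

(** * Counting the epochs of a sequence *)

(** Unboundedness rules out the junk value of [count_upto]; the epochs may
    reach +oo, as they do for a station without external arrivals. *)
Record proper_epochs (R : realType) (e : nat -> \bar R) : Prop := {
  epoch0 : e 0%N = 0%E ;
  epoch_leS : forall n, (e n <= e n.+1)%E ;
  epoch_unbounded : forall t : R, exists n, (t%:E < e n)%E
}.

Section Counting.
Variables (R : realType) (e : nat -> \bar R).
Hypothesis e_proper : proper_epochs e.

Lemma epoch_mono : {homo e : m n / (m <= n)%N >-> (m <= n)%E}.
Proof. by apply: homo_leq (epoch_leS e_proper) => //; exact: le_trans. Qed.

Lemma count_uptoE (t : R) n : (e n <= t%:E)%E -> (t%:E < e n.+1)%E ->
  count_upto e t = n.
Proof.
move=> en tn; apply: xget_unique.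
  split=> // m em; rewrite leqNgt; apply/negP => nm.
  by move: (lt_le_trans tn (epoch_mono nm)); rewrite ltNge em.
move=> m [em mmax]; apply/eqP; rewrite eqn_leq mmax// andbT leqNgt.
apply/negP => nm.
by move: (lt_le_trans tn (epoch_mono nm)); rewrite ltNge em.
Qed.

Lemma epoch_split (Q : pred (\bar R)) :
  Q 0%E -> (exists n, ~~ Q (e n)) -> exists n, Q (e n) /\ ~~ Q (e n.+1).
Proof.
move=> Q0 exQ; case: (ex_minnP exQ) => -[|n]; first by rewrite epoch0// Q0.
move=> Qn nmin; exists n; split=> //; apply/negPn/negP => /nmin.
by rewrite ltnn.
Qed.

Lemma count_upto_bounds (t : R) : 0 <= t ->
  (e (count_upto e t) <= t%:E)%E /\ (t%:E < e (count_upto e t).+1)%E.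
Proof.
move=> t0; have [||n [en tn]] := @epoch_split (fun x => (x <= t%:E)%E).
- by rewrite lee_fin.
- by have [n tn] := epoch_unbounded e_proper t; exists n; rewrite -ltNge.
by rewrite -ltNge in tn; rewrite (count_uptoE en tn).
Qed.

(** The Galois connection between epochs and counts, through which inequalities
    between completion counts and completion epochs are exchanged below. *)
Lemma count_upto_geq (t : R) n : 0 <= t ->
  (n <= count_upto e t)%N = (e n <= t%:E)%E.
Proof.
move=> t0; have [le_t lt_t] := count_upto_bounds t0.
apply/idP/idP => [/epoch_mono/le_trans|en]; first exact.
rewrite leqNgt; apply/negP => /epoch_mono/(lt_le_trans lt_t).
by rewrite ltNge en.
Qed.

Lemma count_upto_lt0 (t : R) : t < 0 -> count_upto e t = 0%N.
Proof.
move=> t0; apply: xgetPN => n [en _]; have := epoch_mono (leq0n n).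
by rewrite (epoch0 e_proper) => /le_trans/(_ en); rewrite lee_fin leNgt t0.
Qed.

Lemma count_upto_homo (s t : R) : s <= t ->
  (count_upto e s <= count_upto e t)%N.
Proof.
move=> st; have [s0|s0] := ltP s 0; first by rewrite count_upto_lt0.
rewrite count_upto_geq ?(le_trans s0)//.
by have [+ _] := count_upto_bounds s0; move/le_trans; apply; rewrite lee_fin.
Qed.

(** Epoch number [left_lim (count_upto e) t] is the last one strictly before
    [t]. *)
Lemma left_lim_count_upto (t : R) : 0 < t ->
  [/\ (e (left_lim (count_upto e) t) < t%:E)%E,
      (t%:E <= e (left_lim (count_upto e) t).+1)%E &
      \forall s \near t^'-, count_upto e s = left_lim (count_upto e) t].
Proof.
move=> t0; have [||n [en tn]] := @epoch_split (fun x => (x < t%:E)%E).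
- by rewrite lte_fin.
- have [n tn] := epoch_unbounded e_proper t; exists n.
  by rewrite -leNgt ltW.
rewrite -leNgt in tn.
have near_n : \forall s \near t^'-, count_upto e s = n.
  have [u ut nu] : exists2 u : R, u < t & (e n <= u%:E)%E.
    have := epoch_mono (leq0n n); rewrite (epoch0 e_proper).
    by case: (e n) en => // u; rewrite lte_fin => ut _; exists u.
  near=> s; apply: count_uptoE.
    by apply: (le_trans nu); rewrite lee_fin; near: s; exact: nbhs_left_ge.
  apply: lt_le_trans tn; rewrite lte_fin; near: s; exact: nbhs_left_lt.
by rewrite (left_limE near_n).
Unshelve. all: by end_near. Qed.

Lemma step_path_count_upto : step_path (count_upto e).
Proof.
split=> t t0; last by case: (left_lim_count_upto t0).
have [en tn] := count_upto_bounds t0.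
have [u tu un] : exists2 u : R, t < u & (u%:E <= e (count_upto e t).+1)%E.
  case: (e _) tn => [u||] //=; rewrite ?lte_fin; first by exists u.
  by move=> _; exists (t + 1); rewrite ?ltrDl// leey.
near=> s; apply: count_uptoE.
  by apply: (le_trans en); rewrite lee_fin; near: s; exact: nbhs_right_ge.
apply: lt_le_trans un; rewrite lte_fin; near: s; exact: nbhs_right_lt.
Unshelve. all: by end_near. Qed.

Lemma count_upto_at0 : (0 < e 1%N)%E -> count_upto e 0 = 0%N.
Proof. by move=> e1; apply: count_uptoE => //; rewrite (epoch0 e_proper). Qed.

End Counting.

(** * Integrals against a counting process *)

(** Positive activity times: then the counting process has unit jumps, and the
    time of a jump determines which activity ends there. *)
Record strict_epochs (R : realType) (e : nat -> R) : Prop := {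
  strict_epoch0 : e 0%N = 0 ;
  strict_epoch_ltS : forall n, e n < e n.+1 ;
  strict_epoch_unbounded : forall t : R, exists n, t < e n
}.

Section Integral.
Variables (R : realType) (e : nat -> R).
Hypothesis e_strict : strict_epochs e.

Let D := count_upto (fun n => (e n)%:E).

Lemma strict_epoch_mono : {mono e : m n / (m <= n)%N >-> m <= n}.
Proof.
apply: le_mono; apply: homo_ltn; first exact: lt_trans.
exact: strict_epoch_ltS.
Qed.

Lemma strict_epoch_ge0 n : 0 <= e n.
Proof. by rewrite -(strict_epoch0 e_strict) strict_epoch_mono. Qed.

Lemma strict_proper_epochs : proper_epochs (fun n => (e n)%:E).
Proof.
split; first by rewrite (strict_epoch0 e_strict).
  by move=> n; rewrite lee_fin ltW// (strict_epoch_ltS e_strict).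
move=> t; have [n tn] := strict_epoch_unbounded e_strict t.
by exists n; rewrite lte_fin.
Qed.

Lemma count_at_epoch n : D (e n) = n.
Proof.
apply: (count_uptoE strict_proper_epochs) => //.
by rewrite lte_fin (strict_epoch_ltS e_strict).
Qed.

Lemma left_lim_count_at_epoch n : left_lim D (e n.+1) = n.
Proof.
have e_gt0 : 0 < e n.+1.
  by rewrite (le_lt_trans (strict_epoch_ge0 n))// (strict_epoch_ltS e_strict).
have [] := left_lim_count_upto strict_proper_epochs e_gt0.
rewrite lte_fin lee_fin ltNge !strict_epoch_mono -/D => + + _.
by rewrite -ltnNge !ltnS => *; apply/eqP; rewrite eqn_leq; apply/andP.
Qed.

Lemma count_jump (t : R) : 0 < t ->
  D t = left_lim D t \/ D t = (left_lim D t).+1 /\ e (left_lim D t).+1 = t.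
Proof.
move=> t0; have [lt_t le_t _] := left_lim_count_upto strict_proper_epochs t0.
rewrite -/D lte_fin lee_fin in lt_t le_t.
move: le_t; rewrite le_eqVlt => /orP[/eqP te|te]; last first.
  by left; apply: (count_uptoE strict_proper_epochs) => //; rewrite lee_fin ltW.
by right; split=> //; rewrite {1}te count_at_epoch.
Qed.

(** The jump times up to [t] are exactly the first [D t] epochs, which turns the
    integral into a sum indexed by activities. *)
Lemma jump_integral_count (g : R -> int) (b : nat -> nat) (t : R) : 0 <= t ->
  jump_integral g (fun s => \sum_(k < D s) b k)%N t =
  \sum_(n < D t) g (e n.+1) * (b n)%:Z.
Proof.
move=> t0; pose F s := (\sum_(k < D s) b k)%N.
have lF s : 0 < s -> left_lim F s = (\sum_(k < left_lim D s) b k)%N.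
  move=> s0; apply: left_limE.
  have [_ _] := left_lim_count_upto strict_proper_epochs s0.
  by apply: filterS => u; rewrite /F /D => ->.
have e_gt0 n : 0 < e n.+1.
  by rewrite (le_lt_trans (strict_epoch_ge0 n))// (strict_epoch_ltS e_strict).
rewrite /jump_integral -(fsbig_widen [set e n.+1 | n in `I_(D t)]).
- rewrite (reindex_fsbig (fun n => e n.+1) `I_(D t)).
    rewrite (fsbig_ord _ _ (fun n => g (e n.+1) * (b n)%:Z)).
    apply: eq_fsbigr => n _; rewrite lF// left_lim_count_at_epoch count_at_epoch.
    by rewrite big_ord_recr/= PoszD addrAC subrr add0r.
  apply: inj_bij => m n _ _ /eqP.
  by rewrite eq_le !strict_epoch_mono -eqn_leq eqSS => /eqP.
- move=> _ [n /= nD <-]; rewrite in_itv/= e_gt0/=.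
  by move: nD; rewrite /D (count_upto_geq strict_proper_epochs)// lee_fin.
move=> s [] /=; rewrite in_itv/= => /andP[s0 st] sD.
rewrite lF//; have [->|[Ds es]] := count_jump s0; first by rewrite subrr mulr0.
case: sD; exists (left_lim D s) => //=; rewrite -Ds.
exact: (count_upto_homo strict_proper_epochs).
Qed.

Lemma jumps_by_integral (g : R -> int) (b : nat -> nat) :
  let F t := (\sum_(k < D t) b k)%N in
  jumps_by (jump_integral g F) (fun t => g t * ((F t)%:Z - (left_lim F t)%:Z)).
Proof.
move=> F; have D_step := step_path_count_upto strict_proper_epochs.
have := jumps_by_comp (fun n => \sum_(k < n) g (e k.+1) * (b k)%:Z) D_step.
apply: eq_jumps_by => t t0 /=; first by rewrite jump_integral_count.
have -> : left_lim F t = (\sum_(k < left_lim D t) b k)%N.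
  by apply: left_limE; apply: filterS (D_step.2 t t0) => s; rewrite /F /D => ->.
rewrite /F -/D; have [->|[-> et]] := count_jump t0.
  by rewrite !subrr mulr0.
by rewrite !big_ord_recr/= et PoszD addrAC subrr add0r addrAC subrr add0r.
Qed.

End Integral.

(** * Monotonicity of the vacation network *)

Definition jump (R : realType) (f : R -> nat) (t : R) : int :=
  (f t)%:Z - (left_lim f t)%:Z.

Section LeftLimits.
Variable R : realType.
Implicit Types f g : R -> nat.

Lemma left_lim_property (Q : nat -> nat -> Prop) f g (t : R) :
  step_path f -> step_path g -> 0 < t ->
  (forall s, 0 <= s -> s < t -> Q (f s) (g s)) ->
  Q (left_lim f t) (left_lim g t).
Proof.
move=> [_ fl] [_ gl] t0 Qs.
have /(@filter_ex _ _ (at_left_proper_filter t))[s [[sf sg] [s0 st]]] :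
    \forall s \near t^'-, (f s = left_lim f t /\ g s = left_lim g t) /\
      (0 <= s /\ s < t).
  apply: filterI; first exact: filterI (fl t t0) (gl t t0).
  by apply: filterI; [exact: nbhs_left_ge|exact: nbhs_left_lt].
by rewrite -sf -sg; exact: Qs.
Qed.

Lemma right_property (Q : nat -> nat -> Prop) f g (t : R) :
  step_path f -> step_path g -> 0 <= t -> Q (f t) (g t) ->
  \forall s \near t^'+, Q (f s) (g s).
Proof.
move=> [fr _] [gr _] t0 Qt.
by apply: filterS2 (fr t t0) (gr t t0) => s -> ->.
Qed.

End LeftLimits.

Lemma leq_sum_ord (m n : nat) (F : nat -> nat) : (m <= n)%N ->
  (\sum_(k < m) F k <= \sum_(k < n) F k)%N.
Proof. by move=> mn; rewrite -(subnKC mn) big_split_ord leq_addr. Qed.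

(** One jump of a single-server queue.  A longer queue stays at least as long
    even if it loses a customer at a jump where the shorter one was empty. *)
Lemma queue_step (xa xb ya yb : nat) (n fa fb dD : int) :
  (xa <= xb)%N -> dD = 0 \/ dD = 1 -> fa <= fb ->
  ya%:Z = xa%:Z + (n + fa - (0 < xa)%N%:Z * dD) ->
  yb%:Z = xb%:Z + (n + fb - (0 < xb)%N%:Z * dD) ->
  (ya <= yb)%N.
Proof.
move=> xab; have : (xa < xb)%N || (xa == xb) by rewrite orbC -leq_eqVlt.
case: xa xab => [|xa]; case: xb => [|xb] // _; lia.
Qed.

(** At the end of an activity the server becomes busy exactly when a customer
    was waiting, whatever it was doing before. *)
Lemma server_step (xa xb sa sb ta tb : nat) (dD : int) :
  (xa <= xb)%N -> (sa <= sb)%N -> (sb <= 1)%N -> dD = 0 \/ dD = 1 ->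
  ta%:Z = sa%:Z + ((0 < xa)%N%:Z - (0 < sa)%N%:Z) * dD ->
  tb%:Z = sb%:Z + ((0 < xb)%N%:Z - (0 < sb)%N%:Z) * dD ->
  (ta <= tb)%N.
Proof.
case: xa => [|xa]; case: xb => [|xb] // _;
case: sa => [|[|sa]] //; case: sb => [|[|sb]] // _ _; lia.
Qed.

Section Vacation.
Variables (R : realType) (d : nat) (N : 'I_d -> R -> nat).
Variables (V : 'I_d -> nat -> R) (r' : 'I_d -> nat -> option 'I_d).
Hypothesis N_step : forall i, step_path (N i).
Hypothesis B_strict : forall i, strict_epochs (activity_epoch V i).

Let D := activity_count V.
Let DD := routed_count V r'.

Lemma activity_step i : step_path (D i).
Proof. exact: step_path_count_upto (strict_proper_epochs (B_strict i)). Qed.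

Lemma activity_countE i : D i = fun t => (\sum_(k < D i t) 1)%N.
Proof. by apply/funext => t; rewrite sum1_card card_ord. Qed.

Lemma activity_count_jump i t : 0 < t -> D i t = left_lim (D i) t \/
  D i t = (left_lim (D i) t).+1 /\ activity_epoch V i (left_lim (D i) t).+1 = t.
Proof. exact: count_jump. Qed.

Lemma activity_jump i t : 0 < t -> jump (D i) t = 0 \/ jump (D i) t = 1.
Proof.
move=> t0; rewrite /jump.
have [->|[-> _]] := activity_count_jump i t0; first by left; rewrite subrr.
by right; rewrite -addn1 PoszD addrC addKr.
Qed.

Lemma left_lim_routed j i t : 0 < t -> left_lim (DD j i) t =
  (\sum_(k < left_lim (D j) t) (r' j k == Some i))%N.
Proof.
move=> t0; apply: left_limE; apply: filterS ((activity_step j).2 t t0) => s.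
by rewrite /DD /routed_count /D => ->.
Qed.

Lemma routed_jump_ge0 j i t : 0 < t -> 0 <= jump (DD j i) t.
Proof.
move=> t0; rewrite /jump subr_ge0 lez_nat left_lim_routed//.
apply: (@leq_sum_ord _ (D j t) (fun k => nat_of_bool (r' j k == Some i))).
by have [->|[-> _]] := activity_count_jump j t0.
Qed.

Lemma jumps_by_activity_integral i g :
  jumps_by (jump_integral g (D i)) (fun t => g t * jump (D i) t).
Proof.
rewrite activity_countE.
exact: (jumps_by_integral (B_strict i) g (fun=> 1%N)).
Qed.

Lemma jumps_by_routed_integral j i g :
  jumps_by (jump_integral g (DD j i)) (fun t => g t * jump (DD j i) t).
Proof.
exact: (jumps_by_integral (B_strict j) g
  (fun k => nat_of_bool (r' j k == Some i))).
Qed.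

Definition routed_flow (S : 'I_d -> R -> nat) i t : int :=
  \sum_(j < d | j != i) (0 < left_lim (S j) t)%N%:Z * jump (DD j i) t.

Section Solution.
Variables Yh S Y : 'I_d -> R -> nat.
Hypothesis sol : vacation_solution N D DD Yh S Y.

Lemma waiting_jump i : step_path (Yh i) /\ forall t, 0 < t ->
  (Yh i t)%:Z = (left_lim (Yh i) t)%:Z +
    (jump (N i) t + routed_flow S i t
     - (0 < left_lim (Yh i) t)%N%:Z * jump (D i) t).
Proof.
apply: jumps_by_nat.
have JN := jumps_byD (jumps_by_cst R ((Yh i 0)%:Z - (N i 0)%:Z))
  (jumps_by_step_path (N_step i)).
have JS := @jumps_by_sum R _ (fun j => j != i) _ _
  (fun j _ => jumps_by_routed_integral j i
     (fun s => (0 < left_lim (S j) s)%N%:Z)).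
have JD := jumps_by_activity_integral i (fun s => (0 < left_lim (Yh i) s)%N%:Z).
apply: eq_jumps_by (jumps_byD (jumps_byD JN JS) (jumps_byN JD)) => t t0 /=.
  have /(canRL (subrK _)) -> := waiting_eq sol i t0.
  by rewrite /cst; ring.
by rewrite add0r.
Qed.

Lemma server_jump i : step_path (S i) /\ forall t, 0 < t ->
  (S i t)%:Z = (left_lim (S i) t)%:Z +
    ((0 < left_lim (Yh i) t)%N%:Z - (0 < left_lim (S i) t)%N%:Z) * jump (D i) t.
Proof.
apply: jumps_by_nat.
have JD := jumps_by_activity_integral i
  (fun s => (0 < left_lim (Yh i) s)%N%:Z - (0 < left_lim (S i) s)%N%:Z).
apply: eq_jumps_by (jumps_byD (jumps_by_cst R (S i 0)%:Z) JD) => t t0 /=.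
  by have /(canRL (subrK _)) -> := in_service_eq sol i t0; rewrite addrC.
by rewrite add0r.
Qed.

Lemma server_le1 i : (S i 0%R <= 1)%N -> forall t, 0 <= t -> (S i t <= 1)%N.
Proof.
have [S_step S_jump] := server_jump i; move=> S0.
apply: real_induction => // t t0.
  move=> St.
  exact: (right_property (Q := fun x _ => (x <= 1)%N) S_step S_step).
move=> /(left_lim_property (Q := fun x _ => (x <= 1)%N) S_step S_step t0) Sl.
move: (S_jump t t0) Sl; have [->|->] := activity_jump i t0.
  by rewrite mulr0 addr0 => -[->].
rewrite mulr1; case: (left_lim (S i) t) => [|[|//]] /=;
  case: (0 < left_lim (Yh i) t)%N => /=; lia.
Qed.

End Solution.

(** The order on the servers is carried along with the order on the queues: a
    server busy in the smaller system is busy in the larger one, so the larger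
    system receives at least as many internal arrivals. *)
Lemma vacation_monotone (Yha Sa Ya Yhb Sb Yb : 'I_d -> R -> nat) :
  vacation_solution N D DD Yha Sa Ya -> vacation_solution N D DD Yhb Sb Yb ->
  (forall i, (Yha i 0%R <= Yhb i 0%R)%N) ->
  (forall i, (Sa i 0%R <= Sb i 0%R)%N) ->
  (forall i, (Sb i 0%R <= 1)%N) ->
  forall t i, 0 <= t -> (Ya i t <= Yb i t)%N.
Proof.
move=> sola solb Y0 S0 Sb1 t i t0.
suff H : forall j, (Yha j t <= Yhb j t)%N /\ (Sa j t <= Sb j t)%N.
  rewrite !(present_eq sola, present_eq solb)//.
  by have [] := H i; exact: leq_add.
move: t t0; apply: real_induction => // t t0.
  move=> H; apply: filter_forall => j.
  have Yr := right_property (Q := leq)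
    (waiting_jump sola j).1 (waiting_jump solb j).1 t0 (H j).1.
  have Sr := right_property (Q := leq)
    (server_jump sola j).1 (server_jump solb j).1 t0 (H j).2.
  by apply: filterS2 Yr Sr => s.
move=> H.
have Yl j : (left_lim (Yha j) t <= left_lim (Yhb j) t)%N.
  apply: (left_lim_property (Q := leq)
    (waiting_jump sola j).1 (waiting_jump solb j).1 t0).
  by move=> s s0 st; case: (H s s0 st j).
have Sl j : (left_lim (Sa j) t <= left_lim (Sb j) t)%N.
  apply: (left_lim_property (Q := leq)
    (server_jump sola j).1 (server_jump solb j).1 t0).
  by move=> s s0 st; case: (H s s0 st j).
have Sbl j : (left_lim (Sb j) t <= 1)%N.
  have [Sb_step _] := server_jump solb j.
  apply: (left_lim_property (Q := fun x _ => (x <= 1)%N) Sb_step Sb_step t0).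
  by move=> s s0 _; exact: server_le1 solb _ (Sb1 j) _ s0.
move=> j; split.
  apply: queue_step (Yl j) (activity_jump j t0) _
    ((waiting_jump sola j).2 t t0) ((waiting_jump solb j).2 t t0).
  apply: ler_sum => k _; rewrite ler_wpM2r ?routed_jump_ge0// lez_nat.
  by have := Sl k; case: (left_lim (Sa k) t) (left_lim (Sb k) t) => [|?] [].
exact: server_step (Yl j) (Sl j) (Sbl j) (activity_jump j t0)
  ((server_jump sola j).2 t t0) ((server_jump solb j).2 t t0).
Qed.

(** Here the comparison is station by station: the arrivals of the autonomous
    network do not depend on its state, and they contain those of the vacation
    network. *)
Lemma waiting_le_autonomous (Yh S Y Y' : 'I_d -> R -> nat) :
  vacation_solution N D DD Yh S Y -> autonomous_solution N D DD Y' ->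
  (forall i, (Yh i 0%R <= Y' i 0%R)%N) ->
  forall t i, 0 <= t -> (Yh i t <= Y' i t)%N.
Proof.
move=> sol sol' Y0 t i.
have [Yh_step Yh_jump] := waiting_jump sol i.
have [Y'_step Y'_jump] : step_path (Y' i) /\ forall t, 0 < t ->
    (Y' i t)%:Z = (left_lim (Y' i) t)%:Z +
    (jump (N i) t + (\sum_(j < d | j != i) jump (DD j i) t)
     - (0 < left_lim (Y' i) t)%N%:Z * jump (D i) t).
  apply: jumps_by_nat.
  have JN := jumps_byD (jumps_by_cst R ((Y' i 0)%:Z - (N i 0)%:Z))
    (jumps_by_step_path (N_step i)).
  have JS := @jumps_by_sum R _ (fun j => j != i) _ _
    (fun j _ => jumps_byD (jumps_by_cst R (- (DD j i 0)%:Z))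
      (jumps_by_comp (fun n => (\sum_(k < n) (r' j k == Some i))%N%:Z)
        (activity_step j))).
  have JD := jumps_by_activity_integral i (fun s => (0 < left_lim (Y' i) s)%N%:Z).
  apply: eq_jumps_by (jumps_byD (jumps_byD JN JS) (jumps_byN JD)) => {}t t0 /=.
    have /(canRL (subrK _)) -> := autonomous_eq sol' i t0.
    under [in RHS]eq_bigr do rewrite addrC.
    by rewrite /cst; ring.
  rewrite add0r; congr (_ + _ - _); apply: eq_bigr => j _; rewrite add0r.
  by rewrite /jump left_lim_routed.
move: t; apply: real_induction => // t t0.
  exact: (right_property (Q := leq)).
move=> /(left_lim_property (Q := leq) Yh_step Y'_step t0) Yl.
apply: queue_step Yl (activity_jump i t0) _ (Yh_jump t t0) (Y'_jump t t0).
apply: ler_sum => j _; rewrite -[leRHS]mul1r ler_wpM2r ?routed_jump_ge0// lez_nat.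
exact: leq_b1.
Qed.

End Vacation.

(** * Comparison of service completions *)

Definition routed_to (d : nat) (r : 'I_d -> nat -> option 'I_d)
    (K : 'I_d -> nat) (i : 'I_d) : nat :=
  (\sum_(j < d) \sum_(k < K j) (r j k == Some i))%N.

Definition exits (d : nat) (r : 'I_d -> nat -> option 'I_d)
    (K : 'I_d -> nat) : nat :=
  (\sum_(j < d) \sum_(k < K j) (r j k == None))%N.

Lemma routed_to_homo (d : nat) (r : 'I_d -> nat -> option 'I_d)
    (K K' : 'I_d -> nat) i :
  (forall j, (K j <= K' j)%N) -> (routed_to r K i <= routed_to r K' i)%N.
Proof.
move=> KK'; apply: leq_sum => j _.
exact: (leq_sum_ord (fun k => nat_of_bool (r j k == Some i))).
Qed.

Lemma exits_homo (d : nat) (r : 'I_d -> nat -> option 'I_d)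
    (K K' : 'I_d -> nat) :
  (forall j, (K j <= K' j)%N) -> (exits r K <= exits r K')%N.
Proof.
move=> KK'; apply: leq_sum => j _.
exact: (leq_sum_ord (fun k => nat_of_bool (r j k == None))).
Qed.

(** Conservation of customers: a service moves its customer to some station or
    out of the network, so internal moves cancel in the total. *)
Lemma population_exits (d : nat) (r : 'I_d -> nat -> option 'I_d)
    (N K Y : 'I_d -> nat) :
  (forall i, (Y i + K i = N i + routed_to r K i)%N) ->
  (\sum_i Y i + exits r K = \sum_i N i)%N.
Proof.
move=> YK.
have {YK} : (\sum_i (Y i + K i) = \sum_i (N i + routed_to r K i))%N.
  by apply: eq_bigr => i _; exact: YK.
rewrite !big_split/= => YK.
suff EK : (exits r K + \sum_i routed_to r K i = \sum_i K i)%N.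
  apply/eqP; rewrite -(eqn_add2r (\sum_i routed_to r K i)) -addnA EK.
  exact/eqP/YK.
rewrite /exits /routed_to exchange_big/= -big_split/=; apply: eq_bigr => j _.
rewrite exchange_big/= -big_split/=.
rewrite -[RHS]card_ord -sum1_card; apply: eq_bigr => k _.
case: (r j k) => [i|]; last by rewrite big1.
rewrite (bigD1 i)//= eqxx big1 ?addn0// => l /negPf li.
by rewrite (inj_eq Some_inj) eq_sym li.
Qed.

Lemma population_le (d : nat) (r : 'I_d -> nat -> option 'I_d)
    (N K Y K' Y' : 'I_d -> nat) :
  (forall i, (Y i + K i = N i + routed_to r K i)%N) ->
  (forall i, (Y' i + K' i = N i + routed_to r K' i)%N) ->
  (forall i, (K' i <= K i)%N) ->
  (\sum_i Y i <= \sum_i Y' i)%N.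
Proof.
move=> /population_exits YK /population_exits YK' /(exits_homo r) KK'.
by rewrite -(leq_add2r (exits r K)) YK -YK' leq_add2l.
Qed.

Section Jackson.
Variables (R : realType) (d : nat) (U : 'I_d -> nat -> \bar R).
Variables (sg : 'I_d -> nat -> R) (r : 'I_d -> nat -> option 'I_d).
Variables (C : 'I_d -> nat -> \bar R) (Y : 'I_d -> R -> nat).
Hypothesis network : jackson_network U sg r C Y.
Hypothesis sg_gt0 : forall i k, 0 < sg i k.
Hypothesis sg_unbounded : forall i (t : R), exists n, t < \sum_(k < n) sg i k.
Hypothesis A_proper : forall i, proper_epochs (arrival_epoch U i).

Let K i t := count_upto (C i) t.

Lemma completion_geS i k : (C i k + (sg i k)%:E <= C i k.+1)%E.
Proof. by rewrite (completionS network) leeD2r// le_max lexx. Qed.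

(** Completions cannot be denser than the service times, so they do not
    accumulate. *)
Lemma completion_proper i : proper_epochs (C i).
Proof.
split; first exact: completion0 network i.
  move=> n; apply: le_trans (completion_geS i n).
  by rewrite leeDl// lee_fin ltW.
move=> t; have [n tn] := sg_unbounded i t; exists n.
apply: (@lt_le_trans _ _ (\sum_(k < n) sg i k)%:E); first by rewrite lte_fin.
elim: n {tn} => [|n IH]; first by rewrite big_ord0 (completion0 network).
apply: le_trans (completion_geS i n).
by rewrite big_ord_recr/= EFinD leeD2r.
Qed.

Lemma total_arrivals_homo i (s t : R) : s <= t ->
  (total_arrivals U r C i s <= total_arrivals U r C i t)%N.
Proof.
move=> st; apply: leq_add; first exact: count_upto_homo.
by apply: (@routed_to_homo _ r (K^~ s) (K^~ t)) => j;
  exact: (count_upto_homo (completion_proper j)).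
Qed.

Lemma total_arrivals_right i (t : R) : 0 <= t ->
  \forall s \near t^'+, total_arrivals U r C i s = total_arrivals U r C i t.
Proof.
move=> t0.
have Kr : \forall s \near t^'+, forall j, K j s = K j t.
  apply: filter_forall => j.
  exact: (step_path_count_upto (completion_proper j)).1.
apply: filterS2 ((step_path_count_upto (A_proper i)).1 t t0) Kr => s As Ks.
rewrite /total_arrivals /external_count As; congr addn.
by apply: eq_bigr => j _; rewrite -/(K j s) Ks.
Qed.

Lemma total_arrival_epoch_le i n (t : R) : (n <= total_arrivals U r C i t)%N ->
  (total_arrival_epoch U r C i n <= t%:E)%E.
Proof. by move=> nt; apply: ereal_inf_lbound; exists t. Qed.

(** The infimum defining an arrival epoch is attained, by right continuity. *)
Lemma total_arrivals_at_epoch i n (t : R) : 0 <= t ->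
  (total_arrival_epoch U r C i n <= t%:E)%E ->
  (n <= total_arrivals U r C i t)%N.
Proof.
move=> t0 Tt; have /(@filter_ex _ _ (at_right_proper_filter t))[s [ts rs]] :
    \forall s \near t^'+, t < s /\
      total_arrivals U r C i s = total_arrivals U r C i t.
  by apply: filterI; [exact: nbhs_right_gt|exact: total_arrivals_right].
rewrite -rs; have Ts : (total_arrival_epoch U r C i n < s%:E)%E.
  by apply: (le_lt_trans Tt); rewrite lte_fin.
apply: contraLR Ts; rewrite -ltnNge -leNgt => ns.
apply: le_ereal_inf_tmp => _ [u nu <-]; rewrite lee_fin leNgt; apply/negP => us.
by move: ns; rewrite ltnNge (leq_trans nu)// total_arrivals_homo// ltW.
Qed.

(** [L i t] counts the services completed at station [i] up to [t] in another
    system with the same arrivals and routing.  The second hypothesis says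
    that this system is slower: if the last of these services has index [k],
    then it started at some time [u], early enough to last at least [sg i k], when
    the [k] previous ones were over and [k.+1] customers had arrived.  At time
    [u], which is before [t], the network was not behind, so it had started
    that service too. *)
Lemma network_is_fastest (L : 'I_d -> R -> nat) :
  (forall i (t : R), 0 <= t -> \forall s \near t^'+, L i s = L i t) ->
  (forall i (t : R) k, 0 <= t -> L i t = k.+1 -> exists u : R,
    [/\ 0 <= u, u + sg i k <= t, (k <= L i u)%N &
        (k < external_count U i u + routed_to r (L^~ u) i)%N]) ->
  forall t : R, 0 <= t -> forall i, (L i t <= count_upto (C i) t)%N.
Proof.
move=> L_right L_start; apply: real_induction.
- move=> i; case Lk: (L i 0) => [//|k].
  have [u [u0 ut _ _]] := L_start i 0 k (lexx _) Lk.
  by move: ut; rewrite leNgt (lt_le_trans (sg_gt0 i k))// lerDr.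
- move=> t t0 LK; apply: filter_forall => i.
  apply: filterS2 (L_right i t t0) (nbhs_right_ge t) => s -> ts.
  exact: leq_trans (LK i) (count_upto_homo (completion_proper i) ts).
- move=> t t0 IH i; case Lk: (L i t) => [//|k].
  have [u [u0 ut kL arr]] := L_start i t k (ltW t0) Lk.
  have ult : u < t by apply: lt_le_trans ut; rewrite ltrDl.
  have Ku := IH u u0 ult.
  rewrite (count_upto_geq (completion_proper i) _ (ltW t0)).
  rewrite (completionS network); apply: (@le_trans _ _ (u + sg i k)%:E); last first.
    by rewrite lee_fin.
  rewrite EFinD leeD2r// ge_max -(count_upto_geq (completion_proper i) _ u0).
  rewrite (leq_trans kL (Ku i))/=; apply: total_arrival_epoch_le.
  by apply: (leq_trans arr); rewrite leq_add2l; exact: (routed_to_homo r i Ku).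
Qed.

Lemma network_population i (t : R) : 0 <= t ->
  (Y i t + count_upto (C i) t =
   external_count U i t + routed_to r (fun j => count_upto (C j) t) i)%N.
Proof.
move=> t0; have := population network i t0; rewrite /total_arrivals -/(routed_to _ _ _).
by move=> E; apply/eqP; rewrite -eqz_nat PoszD E subrK.
Qed.

End Jackson.

(** In the slower network the [k.+1]-st service at [i] starts at the maximum of
    the previous completion epoch and of the arrival epoch of its customer. *)
Lemma slower_service_population (R : realType) (d : nat)
    (U : 'I_d -> nat -> \bar R) (sg sg0 : 'I_d -> nat -> R)
    (r : 'I_d -> nat -> option 'I_d) (C C0 : 'I_d -> nat -> \bar R)
    (Y Y0 : 'I_d -> R -> nat) :
  jackson_network U sg r C Y -> jackson_network U sg0 r C0 Y0 ->
  (forall i, proper_epochs (arrival_epoch U i)) ->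
  (forall i k, 0 < sg i k) -> (forall i k, sg i k <= sg0 i k) ->
  (forall i (t : R), exists n, t < \sum_(k < n) sg i k) ->
  forall t : R, 0 <= t -> (\sum_i Y i t <= \sum_i Y0 i t)%N.
Proof.
move=> net net0 A_proper sg_gt0 sg_le sg_unb t t0.
have sg0_gt0 i k : 0 < sg0 i k by exact: lt_le_trans (sg_le i k).
have sg0_unb i (u : R) : exists n, u < \sum_(k < n) sg0 i k.
  have [n un] := sg_unb i u; exists n; apply: (lt_le_trans un).
  exact: ler_sum.
have C0_proper := completion_proper net0 sg0_gt0 sg0_unb.
suff C0_le i : (count_upto (C0 i) t <= count_upto (C i) t)%N.
  exact: population_le (fun i => network_population net i t0)
    (fun i => network_population net0 i t0) C0_le.
move: t t0 i; apply: (network_is_fastest net sg_gt0 sg_unb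
  (L := fun i => count_upto (C0 i))).
  by move=> i; exact: (step_path_count_upto (C0_proper i)).1.
move=> i t k t0 Kt.
have : (C0 i k.+1 <= t%:E)%E by rewrite -(count_upto_geq (C0_proper i))// Kt.
(* [m] is the epoch at which the slower network starts this service *)
rewrite (completionS net0); set m := maxe _ _ => mt.
have C0m : (C0 i k <= m)%E by rewrite le_max lexx.
have m0 : (0 <= m)%E.
  by apply: le_trans C0m; rewrite -(completion0 net0 i) (epoch_mono (C0_proper i)).
have Tm : (total_arrival_epoch U r C0 i k.+1 <= m)%E by rewrite le_max lexx orbT.
case: m m0 C0m Tm mt => [u||]//; rewrite -EFinD !lee_fin => u0 C0u Tu ut; exists u.
split=> //.
- by apply: le_trans ut; rewrite lerD2l.
- by rewrite (count_upto_geq (C0_proper i)).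
- exact: total_arrivals_at_epoch net0 sg0_gt0 sg0_unb A_proper _ _ _ u0 Tu.
Qed.

(** Summing over the selected indices, or over their ranks among the selected
    ones. *)
Lemma sum_indexed_by_count (b : nat -> bool) (x y : nat -> nat) (m : nat) :
  (forall n, b n -> x (\sum_(l < n) b l)%N = y n) ->
  (\sum_(n < m) b n * y n = \sum_(k < \sum_(n < m) b n) x k)%N.
Proof.
move=> xy; elim: m => [|m IH]; first by rewrite !big_ord0.
rewrite [LHS]big_ord_recr/= IH [in RHS]big_ord_recr/=.
have := xy m; case: (b m) => /= xm; last by rewrite mul0n !addn0.
by rewrite addn1 big_ord_recr/= xm// mul1n.
Qed.

Lemma last_counted (b : nat -> bool) (m k : nat) :
  (\sum_(n < m) b n = k.+1)%N ->
  exists n, [/\ (n < m)%N, b n & (\sum_(l < n) b l = k)%N].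
Proof.
elim: m => [|m IH]; first by rewrite big_ord0.
rewrite big_ord_recr/=; case bm: (b m); rewrite ?addn1 ?addn0.
  by case=> <-; exists m.
by move=> /IH[n [nm bn nk]]; exists n; rewrite ltnW.
Qed.

Section VacationServices.
Variables (R : realType) (d : nat) (U : 'I_d -> nat -> \bar R).
Variables (V : 'I_d -> nat -> R) (r' : 'I_d -> nat -> option 'I_d).
Hypothesis no_arrival_at0 : forall i, external_count U i 0 = 0%N.
Hypothesis B_strict : forall i, strict_epochs (activity_epoch V i).

Let D := activity_count V.
Let DD := routed_count V r'.

Variables Yh S Y : 'I_d -> R -> nat.
Hypothesis sol : vacation_solution (external_count U) D DD Yh S Y.
Hypothesis empty : forall i, Yh i 0 = 0%N /\ S i 0 = 0%N.

Variables (sg0 v : 'I_d -> nat -> R) (r : 'I_d -> nat -> option 'I_d).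
Hypothesis extr : extraction V r' S sg0 r v.
Hypothesis no_self_routing : forall j k, r j k != Some j.

Definition served i t := (\sum_(n < D i t) serving V S i n)%N.

Lemma activity_integralE i g t : 0 <= t ->
  jump_integral g (D i) t = \sum_(n < D i t) g (activity_epoch V i n.+1).
Proof.
move=> t0; rewrite /D {1}(activity_countE V i).
rewrite (jump_integral_count (B_strict i) g (fun=> 1%N) t0).
by apply: eq_bigr => n _; rewrite mulr1.
Qed.

(** The server changes state only at the end of an activity, so an activity
    that ends as a service was one from its start. *)
Lemma serving_between i n : serving V S i n -> S i (activity_epoch V i n) = 1%N.
Proof.
move=> /eqP <-; apply/esym/left_limE.
have B0 := strict_epoch_ge0 (B_strict i) n.
have B_gt0 : 0 < activity_epoch V i n.+1.
  exact: le_lt_trans B0 (strict_epoch_ltS (B_strict i) n).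
have DB : D i (activity_epoch V i n) = n by exact: count_at_epoch.
have DBl : left_lim (D i) (activity_epoch V i n.+1) = n.
  exact: left_lim_count_at_epoch.
apply: filterS2 (nbhs_left_ge B_gt0)
  ((activity_step B_strict i).2 _ B_gt0) => s s0 Ds.
apply/eqP; rewrite -eqz_nat -(inj_eq (addIr (- (S i 0)%:Z))).
rewrite (in_service_eq sol i s0) (in_service_eq sol i B0).
by rewrite !activity_integralE// -/(D i) in Ds *; rewrite Ds DBl DB.
Qed.

Lemma service_busy i n :
  (0 < left_lim (S i) (activity_epoch V i n.+1))%N = serving V S i n.
Proof.
have B_gt0 : 0 < activity_epoch V i n.+1.
  exact: le_lt_trans (strict_epoch_ge0 (B_strict i) n)
    (strict_epoch_ltS (B_strict i) n).
have [S_step _] := server_jump B_strict sol i.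
have : (left_lim (S i) (activity_epoch V i n.+1) <= 1)%N.
  apply: (left_lim_property (Q := fun x _ => (x <= 1)%N) S_step S_step B_gt0).
  move=> s s0 _; apply: (server_le1 B_strict sol) => //.
  by have [_ ->] := empty i.
by rewrite /serving; case: (left_lim _ _) => [|[]].
Qed.

(** The indicators r' used at the end of a vacation are ignored, and those used
    at the end of a service are, in order, the r of the extracted sequence. *)
Lemma routed_services j i t : 0 <= t ->
  jump_integral (fun s => (0 < left_lim (S j) s)%N%:Z) (DD j i) t =
  (\sum_(k < served j t) (r j k == Some i))%N%:Z.
Proof.
move=> t0.
rewrite (jump_integral_count (B_strict j) _
  (fun k => nat_of_bool (r' j k == Some i)) t0).
rewrite -(@sum_indexed_by_count _ (fun k => nat_of_bool (r j k == Some i))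
  (fun n => nat_of_bool (r' j n == Some i))); last first.
  by move=> n bn; have := extr j n; rewrite bn => -[_ ->].
rewrite (big_morph Posz PoszD (erefl _)); apply: eq_bigr => n _.
by rewrite PoszM service_busy.
Qed.

Lemma vacation_population i t : 0 <= t ->
  (Y i t + served i t = external_count U i t + routed_to r (served^~ t) i)%N.
Proof.
move=> t0; rewrite (present_eq sol)//; have [Yh0 S0] := empty i.
have := waiting_eq sol i t0; have := in_service_eq sol i t0.
rewrite Yh0 S0 no_arrival_at0 !subr0 !activity_integralE// sumrB => SE YE.
apply/eqP; rewrite -eqz_nat !PoszD SE YE; apply/eqP.
have -> : (served i t)%:Z = \sum_(n < D i t)
    (0 < left_lim (S i) (activity_epoch V i n.+1))%N%:Z.
  rewrite /served (big_morph Posz PoszD (erefl _)).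
  by apply: eq_bigr => n _; rewrite service_busy.
have -> : (routed_to r (served^~ t) i)%:Z = \sum_(j < d | j != i)
    jump_integral (fun s => (0 < left_lim (S j) s)%N%:Z) (DD j i) t.
  rewrite /routed_to (big_morph Posz PoszD (erefl _)) (bigD1 i)//=.
  rewrite [X in X%:Z + _]big1 ?add0r; last first.
    by move=> k _; rewrite (negPf (no_self_routing i k)).
  by apply: eq_bigr => j _; rewrite routed_services.
ring.
Qed.

(** A service of the vacation network is a whole activity.  It starts at the
    end of the previous one with its customer in service, hence after the
    arrival of enough customers. *)
Lemma vacation_population_ge (C : 'I_d -> nat -> \bar R) (Y0 : 'I_d -> R -> nat) :
  jackson_network U sg0 r C Y0 ->
  (forall i k, 0 < sg0 i k) ->
  (forall i (t : R), exists n, t < \sum_(k < n) sg0 i k) ->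
  forall t : R, 0 <= t -> (\sum_i Y0 i t <= \sum_i Y i t)%N.
Proof.
move=> net sg0_gt0 sg0_unb t t0.
suff served_le i : (served i t <= count_upto (C i) t)%N.
  exact: population_le (fun i => network_population net i t0)
    (fun i => vacation_population i t0) served_le.
move: t t0 i; apply: (network_is_fastest net sg0_gt0 sg0_unb
  (L := served)).
  move=> i t t0; 
  apply: filterS ((activity_step B_strict i).1 t t0) => s.
  by rewrite /served /D => ->.
move=> i t k t0 /last_counted[n [nt bn nk]].
have [sgV _] : sg0 i k = V i n /\ r i k = r' i n.
  by have := extr i n; rewrite bn nk.
have u0 := strict_epoch_ge0 (B_strict i) n.
have served_n : served i (activity_epoch V i n) = k.
  by rewrite /served /D /activity_count (count_at_epoch (B_strict i)).
(* activity [n] is service [k], and it starts at epoch [n] *)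
exists (activity_epoch V i n); split=> //.
- rewrite sgV; move: nt.
  rewrite (count_upto_geq (strict_proper_epochs (B_strict i)))// lee_fin.
  by rewrite /activity_epoch big_ord_recr.
- by rewrite served_n.
- rewrite -vacation_population// served_n -[ltnLHS]add0n ltn_add2r.
  by rewrite (present_eq sol)// (serving_between bn) addn1.
Qed.

End VacationServices.

(** * Almost sure properties of the driving sequences *)

Lemma unbounded_partial_sums (R : realType) (x : nat -> \bar R) (eps : R) :
  0 < eps -> (forall n, (0 <= x n)%E) ->
  (forall m, exists2 n, (m <= n)%N & (eps%:E < x n)%E) ->
  forall t : R, exists n, (t%:E < \sum_(k < n) x k)%E.
Proof.
move=> eps0 x0 x_often t.
have sum_mono m n : (m <= n)%N -> (\sum_(k < m) x k <= \sum_(k < n) x k)%E.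
  by move=> mn; rewrite -(subnKC mn) big_split_ord/= leeDl// sume_ge0.
have sum_ge j : exists n, ((j%:R * eps)%:E <= \sum_(k < n) x k)%E.
  elim: j => [|j [m jm]]; first by exists 0%N; rewrite big_ord0 mul0r.
  have [n mn xn] := x_often m; exists n.+1.
  rewrite big_ord_recr/= -natr1 mulrDl mul1r EFinD; apply: leeD (ltW xn).
  exact: le_trans jm (sum_mono _ _ mn).
have [n jn] := sum_ge (Num.bound `|t / eps|); exists n.
apply: (lt_le_trans _ jn); rewrite lte_fin -ltr_pdivrMr//.
exact: le_lt_trans (ler_norm _) (archi_boundP (normr_ge0 _)).
Qed.

Section Probability.
Context {disp} {Omega : measurableType disp} {R : realType}.
Variable P : probability Omega R.

Lemma ae_avoid {d'} {T : measurableType d'} (X : {RV P >-> T}) (B : set T) :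
  measurable B -> P (X @^-1` B) = 0%E -> {ae P, forall w, ~ B (X w)}.
Proof.
move=> mB PB; exists (X @^-1` B); split=> //.
- exact: measurable_funPTI.
- by move=> w /= /contrapT.
Qed.

(** An elementary case of the second Borel-Cantelli lemma: [l] consecutive
    events hold together with probability at most [q ^+ l]. *)
Lemma independent_infinitely_often (I : eqType) (F : I -> set (set Omega))
    (f : nat -> I) (E : nat -> set Omega) (q : R) :
  mutually_independent P F -> injective f -> (forall n, F (f n) (E n)) ->
  (forall n, measurable (E n)) -> q < 1 -> (forall n, (P (E n) <= q%:E)%E) ->
  {ae P, forall w, forall m, exists2 n, (m <= n)%N & ~ E n w}.
Proof.
move=> indep f_inj FE mE q1 Eq; apply: ae_foralln => m.
have q0 : 0 <= q by rewrite -lee_fin (le_trans _ (Eq 0%N)).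
pose A := \bigcap_n E (m + n)%N.
have mA : measurable A by exact: bigcapT_measurable.
(* [E] extended to all indices of the independent family; [f] is injective *)
pose E' x := [set w | forall n, f n = x -> E n w].
have E'E n : E' (f n) = E n.
  apply/seteqP; split=> w; first by apply.
  by move=> Ew k /f_inj ->.
have PAq l : (P A <= (q ^+ l)%:E)%E.
  pose s := [seq f (m + n)%N | n <- iota 0 l].
  have s_uniq : uniq s.
    by rewrite map_inj_uniq ?iota_uniq// => i j /f_inj /addnI.
  have PE : P (\big[setI/[set: Omega]]_(i <- s) E' i) =
      (\prod_(i <- s) P (E' i))%E.
    by apply: indep => // _ /mapP[n _ ->]; rewrite E'E.
  have mBig : measurable (\big[setI/[set: Omega]]_(i <- s) E' i).
    by rewrite big_map; apply: bigsetI_measurable => n _; rewrite E'E.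
  have AE' : A `<=` \big[setI/[set: Omega]]_(i <- s) E' i.
    rewrite big_map => w Aw; elim: (iota 0 l) => [|n r IH].
      by rewrite big_nil.
    by rewrite big_cons; split=> //; rewrite E'E; exact: Aw.
  have : (P A <= P (\big[setI/[set: Omega]]_(i <- s) E' i))%E.
    by apply: le_measure; rewrite ?inE.
  move/le_trans; apply; rewrite PE big_map.
  rewrite -[X in (_ <= (_ ^+ X)%:E)%E](size_iota 0 l).
  elim: (iota 0 l) => [|n r IH]; first by rewrite big_nil.
  by rewrite big_cons/= exprS EFinM E'E lee_pmul// prode_ge0.
have PA0 : P A = 0%E.
  apply/eqP; rewrite eq_le measure_ge0 andbT.
  rewrite -(fineK (fin_num_measure P _ mA)) lee_fin.
  have q_lt1 : `|q| < 1 by rewrite ger0_norm.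
  apply: (cvgr_to_ge (cvg_expr q_lt1)); apply: nearW => l.
  by rewrite -lee_fin fineK ?fin_num_measure.
exists A; split=> // w /= /forall2NP H n _.
have [/negP|/contrapT//] := H (m + n)%N.
by rewrite leq_addr.
Qed.

(** The distribution function vanishes to the left of 0, hence at 0, and it is
    still at most one half a little to the right. *)
Lemma continuous_law_near0 (X : {RV P >-> R}) :
  (forall w, 0 <= X w) -> continuous_law P (fun w => (X w)%:E) ->
  P (X @^-1` `]-oo, 0]) = 0%E /\
  exists2 eps : R, 0 < eps & (P (X @^-1` `]-oo, eps]) <= (2^-1)%:E)%E.
Proof.
move=> X0 Xc; pose F x := P (X @^-1` `]-oo, x]).
have FE : (fun x : R => P [set w | ((X w)%:E <= x%:E)%E]) = F.
  by apply/funext => x; congr (P _).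
rewrite /continuous_law FE in Xc.
have F0 : F 0 = 0%E.
  apply/eqP; rewrite eq_le measure_ge0 andbT.
  apply: (cvge_to_le (cvg_at_left_filter (Xc 0))); near=> x.
  rewrite /F (_ : X @^-1` _ = set0) ?measure0//.
  apply/seteqP; split=> w //=; rewrite in_itv/= => Xx.
  have : x < 0 by near: x; exact: nbhs_left_lt.
  by rewrite ltNge (le_trans (X0 w)).
split; first exact: F0.
have half : nbhs (F 0) [set y : \bar R | (y < (2^-1)%:E)%E].
  apply: open_nbhs_nbhs; split; first exact: open_ereal_lt_ereal.
  by rewrite /= F0 lte_fin invr_gt0.
have [eps /= eps0 Feps] := Xc 0 _ half.
exists (eps / 2); first by rewrite divr_gt0.
apply/ltW/(Feps (eps / 2)) => /=.
by rewrite sub0r normrN gtr0_norm ?divr_gt0// ltr_pdivrMr// ltr_pMr// ltr1n.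
Unshelve. all: by end_near. Qed.

(** Terms exceeding [eps] occur infinitely often, so no finite time
    accumulates infinitely many epochs. *)
Lemma renewal_epochs (I : eqType) (F : I -> set (set Omega)) (f : nat -> I)
    (X : nat -> {RV P >-> R}) (eps q : R) :
  mutually_independent P F -> injective f -> (forall n, F (f n) = events (X n)) ->
  (forall n, P (X n @^-1` `]-oo, 0]) = 0%E) ->
  0 < eps -> q < 1 -> (forall n, (P (X n @^-1` `]-oo, eps]) <= q%:E)%E) ->
  {ae P, forall w, (forall n, 0 < X n w) /\
    forall t : R, exists n, t < \sum_(k < n) X k w}.
Proof.
move=> indep f_inj FX X0 eps0 q1 Xq.
have X_pos : {ae P, forall w, forall n, 0 < X n w}.
  apply: ae_foralln => n; apply: filterS (ae_avoid _ (X0 n)) => //.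
  by move=> w /=; rewrite in_itv/= => /negP; rewrite -ltNge.
have X_often := independent_infinitely_often indep f_inj
  (E := fun n => X n @^-1` `]-oo, eps]) _ _ q1 Xq.
apply: filterS2 X_pos (X_often _ _).
- move=> w Xw Xoften; split=> // t.
  have [] := @unbounded_partial_sums R (fun n => (X n w)%:E) eps eps0 _ _ t.
  + by move=> n; rewrite lee_fin ltW.
  + move=> m; have [n mn Xn] := Xoften m; exists n => //.
    by rewrite lte_fin ltNge; apply/negP => h; apply: Xn; rewrite /= in_itv.
  + by move=> n; rewrite sumEFin lte_fin; exists n.
- by move=> n; rewrite FX; exists `]-oo, eps]%classic; rewrite ?setTI.
- by move=> n; exact: measurable_funPTI.
Qed.

End Probability.

Section Primitives.
Context {disp} {Omega : measurableType disp} {R : realType}.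
Variables (P : probability Omega R) (d : nat).
Variables (lam mu a : 'I_d -> R) (Q : 'M[R]_d).
Variables (U : 'I_d -> nat -> {RV P >-> \bar R}).
Variables (sg V : 'I_d -> nat -> {RV P >-> R}).
Variables (r r' : 'I_d -> nat -> {RV P >-> option 'I_d}).
Hypothesis prim : network_primitives lam mu Q U sg r.
Hypothesis stand : standing_assumptions lam U sg.

Lemma service_renewal i : {ae P, forall w, (forall k, 0 < sg i k w) /\
  forall t : R, exists n, t < \sum_(k < n) sg i k w}.
Proof.
have sg_cont : continuous_law P (fun w => (sg i 0%N w)%:E).
  exact: sg_continuous stand _.
have [sg0 [eps eps0 sg_eps]] := continuous_law_near0 (sg_ge0 prim i 0%N) sg_cont.
have f_inj : injective (fun n : nat =>
    inl (inr (i, n)) : 'I_d * nat + 'I_d * nat + 'I_d * nat).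
  by move=> m n [].
apply: (renewal_epochs (primitives_independent prim) f_inj _ _ eps0
  (q := 2^-1) _ _) => //.
- by move=> n; rewrite (sg_same_law prim i n).
- by rewrite invf_lt1 ?ltr1n.
- by move=> n; rewrite (sg_same_law prim i n).
Qed.

(** Activities are distributed as the slowed down service times, which exceed
    the original ones; the bounds on the law of the latter carry over. *)
Lemma activity_renewal (apar : forall i, 1 <= a i)
    (aut : autonomous_primitives Q a U sg V r') i :
  {ae P, forall w, (forall k, 0 < V i k w) /\
    forall t : R, exists n, t < \sum_(k < n) V i k w}.
Proof.
have sg_cont : continuous_law P (fun w => (sg i 0%N w)%:E).
  exact: sg_continuous stand _.
have [sg0 [eps eps0 sg_eps]] := continuous_law_near0 (sg_ge0 prim i 0%N) sg_cont.
have V_le n (x : R) :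
    (P (V i n @^-1` `]-oo, x]) <= P (sg i 0%N @^-1` `]-oo, x]))%E.
  rewrite (V_law aut i n)//; apply: le_measure; rewrite ?inE.
  - rewrite -[X in measurable X]setTI.
    have ma : measurable_fun [set: Omega] (fun w => a i * sg i 0%N w).
      exact: measurable_funM.
    by apply: ma.
  - exact: measurable_funPTI.
  - move=> w /=; rewrite !in_itv/=; apply: le_trans.
    by rewrite ler_peMl// (sg_ge0 prim).
have f_inj : injective (fun n : nat =>
    inl (inr (i, n)) : 'I_d * nat + 'I_d * nat + 'I_d * nat).
  by move=> m n [].
apply: (renewal_epochs (autonomous_independent aut) f_inj _ _ eps0
  (q := 2^-1) _ _) => //.
- move=> n; apply/eqP; rewrite eq_le measure_ge0 andbT.
  by rewrite -[leRHS]sg0.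
- by rewrite invf_lt1 ?ltr1n.
- by move=> n; apply: le_trans (V_le n eps) _.
Qed.

(** Arrival epochs increase, so the second interarrival time is positive, and
    the first one has the same law.  Since they exceed 1 with positive
    probability, arrivals do not accumulate. *)
Lemma arrival_renewal i : 0 <= lam i -> {ae P, forall w,
  proper_epochs (arrival_epoch (fun i n => U i n w) i) /\
  external_count (fun i n => U i n w) i 0 = 0%N}.
Proof.
move=> lam_ge0.
have U0 n w := U_ge0 prim i n w.
suff : {ae P, forall w, (0 < U i 0%N w)%E /\
    forall t : R, exists n, (t%:E < arrival_epoch (fun i n => U i n w) i n)%E}.
  apply: filterS => w [U_pos U_unb].
  have A_proper : proper_epochs (arrival_epoch (fun i n => U i n w) i).
    split=> //; first by rewrite /arrival_epoch big_ord0.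
    by move=> n; rewrite /arrival_epoch big_ord_recr/= leeDl.
  split=> //; apply: (count_upto_at0 A_proper).
  by rewrite /arrival_epoch big_ord_recr big_ord0/= add0e.
have [lam_gt0|] := ltP 0 (lam i); last first.
  move=> lam_le0; have lam0 : lam i = 0 by apply/eqP; rewrite eq_le lam_le0.
  apply: aeW => w; rewrite (U_none prim lam0); split=> [|t]; first by rewrite ltry.
  exists 1%N; rewrite /arrival_epoch big_ord_recr big_ord0/= add0e.
  by rewrite (U_none prim lam0) ltry.
have m_le (x : \bar R) : measurable (`]-oo, x]%classic : set (\bar R)).
  exact: emeasurable_itv.
have U_pos : {ae P, forall w, (0 < U i 0%N w)%E}.
  have P0 : P (U i 0%N @^-1` `]-oo, 0%E]) = 0%E.
    rewrite -(U_same_law prim i 1%N)// (_ : _ @^-1` _ = set0) ?measure0//.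
    apply/seteqP; split=> w //=; rewrite in_itv/= => U1.
    have {U1} U1 : U i 1%N w = 0%E by apply/eqP; rewrite eq_le U1 U0.
    have := A_increasing prim lam_gt0 0%N w.
    by rewrite /arrival_epoch !big_ord_recr big_ord0/= add0e U1 adde0 ltxx.
  apply: filterS (ae_avoid (m_le 0%E) P0) => w /=.
  by rewrite in_itv/= => /negP; rewrite -ltNge.
have P1 : (P (U i 0%N @^-1` `]-oo, 1%E]) < 1)%E.
  rewrite (_ : U i 0%N @^-1` _ = ~` [set w | (1%:E < U i 0%N w)%E]); last first.
    apply/seteqP; split=> w /=; rewrite in_itv/= leNgt; first by move/negP.
    by move=> h; apply/negP.
  rewrite probability_setC; last first.
    rewrite (_ : [set w | _] = U i 0%N @^-1` `]1%:E, +oo[).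
      exact/measurable_funPTI/emeasurable_itv.
    by apply/seteqP; split=> w /=; rewrite in_itv/= andbT.
  rewrite gte_subl//. exact: (U_unbounded stand lam_gt0 ltr01).
pose q := fine (P (U i 0%N @^-1` `]-oo, 1%E])).
have qE : P (U i 0%N @^-1` `]-oo, 1%E]) = q%:E.
  by rewrite fineK// fin_num_measure//; exact: measurable_funPTI.
have f_inj : injective (fun n : nat =>
    inl (inl (i, n)) : 'I_d * nat + 'I_d * nat + 'I_d * nat).
  by move=> m n [].
have U_often := independent_infinitely_often (primitives_independent prim) f_inj
  (E := fun n => U i n @^-1` `]-oo, 1%E]) (q := q).
apply: filterS2 U_pos (U_often _ _ _ _).
- move=> w U_pos Uoften; split=> //.
  apply: (unbounded_partial_sums (@ltr01 R)) => //.
  move=> m; have [n mn Un] := Uoften m; exists n => //.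
  by rewrite ltNge; apply/negP => h; apply: Un; rewrite /= in_itv.
- by move=> n; exists `]-oo, 1%E]%classic; rewrite ?setTI.
- by move=> n; exact: measurable_funPTI.
- by rewrite -lte_fin -qE.
- by move=> n; rewrite (U_same_law prim i n)// qE.
Qed.

Lemma no_self_routing_ae (Q_diag : forall i, Q i i = 0) i k :
  {ae P, forall w, r i k w != Some i}.
Proof.
have [rE _] := r_law prim i k.
have mS : measurable ([set Some i] : set (option 'I_d)) by [].
have P0 : P (r i k @^-1` [set Some i]) = 0%E by rewrite rE Q_diag.
by apply: filterS (ae_avoid mS P0) => w ri; apply/eqP.
Qed.

End Primitives.

Lemma renewal_strict_epochs (R : realType) (d : nat) (V : 'I_d -> nat -> R) i :
  (forall k, 0 < V i k) -> (forall t : R, exists n, t < \sum_(k < n) V i k) ->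
  strict_epochs (activity_epoch V i).
Proof.
move=> V_gt0 V_unb; split=> //; first by rewrite /activity_epoch big_ord0.
by move=> n; rewrite /activity_epoch big_ord_recr/= ltrDl.
Qed.

Theorem theorem1 (R : realType) (d : nat)
  (disp : measure_display) (Omega : measurableType disp)
  (P : probability Omega R)
  (lam mu a : 'I_d -> R) (Q : 'M[R]_d)
  (U : 'I_d -> nat -> {RV P >-> \bar R})
  (sg v V : 'I_d -> nat -> {RV P >-> R})
  (r r' : 'I_d -> nat -> {RV P >-> option 'I_d})
  (* completion epochs of N and N^0 *)
  (C C0 : 'I_d -> nat -> Omega -> \bar R)
  (* populations of N, N^0, N^+ (waiting, in service, total) and N' *)
  (Y Y0 Yh S Yp Y' : 'I_d -> R -> Omega -> nat)
  (Hpar : network_parameters lam mu Q)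
  (Hslow : slowdown_parameters lam mu Q a)
  (Hprim : network_primitives lam mu Q U sg r)
  (Hstand : standing_assumptions lam U sg)
  (Hvac : vacation_primitives a U sg r v)
  (Haut : autonomous_primitives Q a U sg V r')
  (HN : {ae P, forall w, jackson_network
     (fun i n => U i n w) (fun i k => sg i k w) (fun i k => r i k w)
     (fun i n => C i n w) (fun i t => Y i t w)})
  (HN0 : {ae P, forall w, jackson_network
     (fun i n => U i n w) (fun i k => a i * sg i k w) (fun i k => r i k w)
     (fun i n => C0 i n w) (fun i t => Y0 i t w)})
  (HNp : {ae P, forall w, vacation_solution
     (external_count (fun i n => U i n w))
     (activity_count (fun i k => V i k w))
     (routed_count (fun i k => V i k w) (fun i k => r' i k w))
     (fun i t => Yh i t w) (fun i t => S i t w) (fun i t => Yp i t w)})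
  (HNp0 : {ae P, forall w, forall i, Yh i 0 w = 0%N /\ S i 0 w = 0%N})
  (HN' : {ae P, forall w, autonomous_solution
     (external_count (fun i n => U i n w))
     (activity_count (fun i k => V i k w))
     (routed_count (fun i k => V i k w) (fun i k => r' i k w))
     (fun i t => Y' i t w)})
  (HN'0 : {ae P, forall w, forall i, Y' i 0 w = 0%N})
  (Hextr : {ae P, forall w, extraction
     (fun i k => V i k w) (fun i k => r' i k w) (fun i t => S i t w)
     (fun i k => a i * sg i k w) (fun i k => r i k w) (fun i k => v i k w)}) :
  {ae P, forall w,
    [/\ (* (i) *)
        forall t : R, 0 < t ->
          (\sum_(i < d) Y i t w <= \sum_(i < d) Y0 i t w)%N /\
          (\sum_(i < d) Y0 i t w <= \sum_(i < d) Yp i t w)%N,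
        (* (ii) *)
        forall (t : R) (i : 'I_d) (y : nat), 0 < t -> Y' i t w = y ->
          (Yp i t w <= y + 1)%N /\ (S i t w = 0%N \/ S i t w = 1%N)
      & (* (iii) *)
        forall (y : 'I_d -> nat)
          (Yh_pp S_pp Y_pp Yh_p S_p Y_p Yh_pm S_pm Y_pm : 'I_d -> R -> nat),
          let N := external_count (fun i n => U i n w) in
          let D := activity_count (fun i k => V i k w) in
          let DD := routed_count (fun i k => V i k w) (fun i k => r' i k w) in
          vacation_solution N D DD Yh_pp S_pp Y_pp ->
          vacation_solution N D DD Yh_p S_p Y_p ->
          vacation_solution N D DD Yh_pm S_pm Y_pm ->
          (forall i, Yh_pp i 0 = (y i + 1)%N /\ S_pp i 0 = 1%N) ->
          (forall i, (Yh_p i 0%R <= y i)%N /\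
                     (S_p i 0 = 0%N \/ S_p i 0 = 1%N)) ->
          (forall i, Yh_pm i 0 = 0%N /\ S_pm i 0 = 0%N) ->
          forall (t : R) (i : 'I_d), 0 <= t ->
            (Y_p i t <= Y_pp i t)%N /\ (Y_pm i t <= Y_p i t)%N]}.
Proof.
have apar := a_ge1 Hslow.
have sg_ae : {ae P, forall w, forall i, (forall k, 0 < sg i k w) /\
    forall t : R, exists n, t < \sum_(k < n) sg i k w}.
  by apply: filter_forall => i; exact: service_renewal Hprim Hstand i.
have V_ae : {ae P, forall w, forall i,
    strict_epochs (activity_epoch (fun i k => V i k w) i)}.
  apply: filter_forall => i.
  apply: filterS (activity_renewal Hprim Hstand apar Haut i) => w [V_gt0 V_unb].
  exact: renewal_strict_epochs.
have A_ae : {ae P, forall w, forall i,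
    proper_epochs (arrival_epoch (fun i n => U i n w) i) /\
    external_count (fun i n => U i n w) i 0 = 0%N}.
  apply: filter_forall => i.
  exact: arrival_renewal Hprim Hstand i (lam_ge0 Hpar i).
have r_ae : {ae P, forall w, forall i k, r i k w != Some i}.
  apply: filter_forall => i; apply: ae_foralln => k.
  exact: no_self_routing_ae Hprim (Q_diag Hpar) i k.
near=> w.
have sgP : forall i, (forall k, 0 < sg i k w) /\
  forall t : R, exists n, t < \sum_(k < n) sg i k w by near: w.
have B_strict : forall i, strict_epochs (activity_epoch (fun i k => V i k w) i).
  by near: w.
have AP : forall i, proper_epochs (arrival_epoch (fun i n => U i n w) i) /\
    external_count (fun i n => U i n w) i 0 = 0%N by near: w.
have r_other : forall i k, r i k w != Some i by near: w.
have net : jackson_network (fun i n => U i n w) (fun i k => sg i k w)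
  (fun i k => r i k w) (fun i n => C i n w) (fun i t => Y i t w) by near: w.
have net0 : jackson_network (fun i n => U i n w) (fun i k => a i * sg i k w)
  (fun i k => r i k w) (fun i n => C0 i n w) (fun i t => Y0 i t w) by near: w.
have sol : vacation_solution (external_count (fun i n => U i n w))
  (activity_count (fun i k => V i k w))
  (routed_count (fun i k => V i k w) (fun i k => r' i k w))
  (fun i t => Yh i t w) (fun i t => S i t w) (fun i t => Yp i t w) by near: w.
have empty : forall i, Yh i 0 w = 0%N /\ S i 0 w = 0%N by near: w.
have sol' : autonomous_solution (external_count (fun i n => U i n w))
  (activity_count (fun i k => V i k w))
  (routed_count (fun i k => V i k w) (fun i k => r' i k w))
  (fun i t => Y' i t w) by near: w.
have empty' : forall i, Y' i 0 w = 0%N by near: w.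
have extr : extraction (fun i k => V i k w) (fun i k => r' i k w)
  (fun i t => S i t w) (fun i k => a i * sg i k w) (fun i k => r i k w)
  (fun i k => v i k w) by near: w.
have A_proper i := (AP i).1.
have A_step i := step_path_count_upto (A_proper i).
have sg_gt0 i := (sgP i).1.
have sg_unb i := (sgP i).2.
have sg_le i k : sg i k w <= a i * sg i k w by rewrite ler_peMl// ltW.
have sg0_gt0 i k : 0 < a i * sg i k w by exact: lt_le_trans (sg_le i k).
have sg0_unb i (t : R) : exists n, t < \sum_(k < n) a i * sg i k w.
  have [n tn] := sg_unb i t; exists n; apply: (lt_le_trans tn).
  by apply: ler_sum => k _.
split.
- move=> t t0; split.
    exact: (slower_service_population net net0 A_proper sg_gt0 sg_le sg_unb
      (ltW t0)).
  exact: (vacation_population_ge (fun i => (AP i).2) B_strict sol empty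
    extr r_other net0 sg0_gt0 sg0_unb (ltW t0)).
- move=> t i y t0 <-.
  have S_le1 : (S i t w <= 1)%N.
    by apply: (server_le1 B_strict sol); rewrite ?ltW//; have [_ ->] := empty i.
  have Yh_le : (Yh i t w <= Y' i t w)%N.
    apply: (waiting_le_autonomous A_step B_strict sol sol'); last exact: ltW.
    by move=> j; have [-> _] := empty j.
  rewrite (present_eq sol i (ltW t0)); split; first exact: leq_add.
  by move: S_le1; case: (S i t w) => [|[|//]] _; [left|right].
- move=> y Yh_pp S_pp Y_pp Yh_p S_p Y_p Yh_pm S_pm Y_pm.
  move=> sol_pp sol_p sol_pm init_pp init_p init_pm t i t0.
  have S_p01 j : (S_p j 0%R <= 1)%N by have [_ [->|->]] := init_p j.
  split.
    apply: (vacation_monotone A_step B_strict sol_p sol_pp) t0 => j.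
    + have [-> _] := init_pp j; have [Yy _] := init_p j.
      by rewrite (leq_trans Yy)// leq_addr.
    + by have [_ ->] := init_pp j.
    + by have [_ ->] := init_pp j.
  apply: (vacation_monotone A_step B_strict sol_pm sol_p) t0 => j //.
  + by have [-> _] := init_pm j.
  + by have [_ ->] := init_pm j.
Unshelve. all: by end_near. Qed.
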